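(* Let $K/k$, $k=\mathbb{F}_q(T)$, be a cyclic extension of degree $p^n$ whose ramified prime divisors are $P_1,\ldots,P_r\in R_T^+$ (distinct) and possibly $\mathfrak{p}_\infty$. Then $K=k(\vec y)$ for a Witt vector $\vec y=(y_1,\dots,y_n)$ of length $n$ satisfying \[ \vec y^{\,p}\ominus\vec y=\vec\beta=\vec\delta_1\oplus\cdots\oplus\vec\delta_r\oplus\vec\mu, \] where $\vec\beta=(\beta_1,\dots,\beta_n)\in W_n(k)$ with $\beta_1\notin\wp(k)$; $\vec\delta_i=(\delta_{i1},\dots,\delta_{in})$ with $\delta_{ij}=\frac{Q_{ij}}{P_i^{e_{ij}}}$, $e_{ij}\ge 0$, $Q_{ij}\in R_T$, and whenever $e_{ij}>0$ one has $p\nmid e_{ij}$, $\gcd(Q_{ij},P_i)=1$ and $\deg Q_{ij}<\deg(P_i^{e_{ij}})$; and $\vec\mu=(\mu_1,\dots,\mu_n)$ with $\mu_j=f_j(T)\in R_T$ and $p\nmid\deg f_j$ whenever $f_j\notin\mathbb{F}_q$.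
   Context: $q$ is a power of the prime $p$, $k=\mathbb{F}_q(T)$, $R_T=\mathbb{F}_q[T]$, $R_T^+$ the set of monic irreducible polynomials of $R_T$, $\mathfrak{p}_\infty$ the pole divisor of $T$ in $k$; all fields lie in a fixed algebraic closure of $k$. For a field $L$ of characteristic $p$, $W_n(L)$ is the ring of Witt vectors of length $n$ over $L$, with Witt addition $\oplus$ and subtraction $\ominus$: these are the operations on $n$-tuples transported from componentwise operations on ghost components $a^{(m)}=a_1^{p^{m-1}}+pa_2^{p^{m-2}}+\cdots+p^{m-1}a_m$ ($1\le m\le n$), i.e. given by the resulting universal integral polynomials reduced mod $p$. For $\vec y=(y_1,\dots,y_n)$, $\vec y^{\,p}=(y_1^p,\dots,y_n^p)$, and $k(\vec y)=k(y_1,\dots,y_n)$. $\wp(k)=\{a^p-a:a\in k\}$. *)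

(* Defs.v *)
From HB Require Import structures.
From mathcomp Require Import all_boot all_order all_algebra all_fingroup all_solvable all_field.
From mathcomp Require Import fraction.
From mathcomp Require Import mpoly.
Set Implicit Arguments. Unset Strict Implicit. Unset Printing Implicit Defensive.
Import Order.TTheory GRing.Theory Num.Theory.
Local Open Scope ring_scope.

Notation ratfun F := {fraction {poly F}}.

(* Witt vectors of length n: universal Witt polynomials.              *)
(* Variables X_0..X_{n-1}, Y_0..Y_{n-1} are 'X_(lshift n i),          *)
(* 'X_(rshift n i) in {mpoly rat[n+n]}.  For a binary operation g on  *)
(* ghost components (addition or subtraction) the polynomials S_m are *)
(* defined recursively by the ghost equations                         *)
(*   sum_{i<=m} p^i S_i^{p^(m-i)} = g(w_m(X), w_m(Y)),                *)
(* (0-indexed, w_m(Z) = sum_{i<=m} p^i Z_i^{p^(m-i)}), computed over  *)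
(* Q; they have integral coefficients, which are then reduced mod p   *)
(* by mapping them into a ring of characteristic p.                   *)
Section Witt.
Variables (p n : nat).
Local Notation MP := {mpoly rat[n + n]}.

Definition wX (i : nat) : MP :=
  match @insub _ (fun k => k < n)%N 'I_n i with
  | Some j => 'X_(lshift n j) | None => 0 end.
Definition wY (i : nat) : MP :=
  match @insub _ (fun k => k < n)%N 'I_n i with
  | Some j => 'X_(rshift n j) | None => 0 end.

Definition ghost (Z : nat -> MP) (m : nat) : MP :=
  \sum_(i < m.+1) (p ^ i)%:R * Z i ^+ (p ^ (m - i)).

Fixpoint witt_polys (g : MP -> MP -> MP) (m : nat) : seq MP :=
  match m with
  | 0 => [::]
  | m'.+1 =>
    let s := witt_polys g m' in
    rcons s (((p ^ m')%:R : rat)^-1 *: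
             (g (ghost wX m') (ghost wY m')
              - \sum_(i < m') (p ^ i)%:R * (nth 0 s i) ^+ (p ^ (m' - i))))
  end.

(* evaluation of an integral polynomial in a ring R (reduction mod char R) *)
Definition witt_op (g : MP -> MP -> MP) (R : comNzRingType)
    (x y : {ffun 'I_n -> R}) : {ffun 'I_n -> R} :=
  [ffun i : 'I_n =>
     mmap (fun c : rat => (numq c)%:~R)
       (fun j : 'I_(n + n) => match split j with inl a => x a | inr b => y b end)
       (nth 0 (witt_polys g n) i)].

Definition witt_add (R : comNzRingType) := @witt_op (fun a b => a + b) R.
Definition witt_sub (R : comNzRingType) := @witt_op (fun a b => a - b) R.

End Witt.

Definition dval (L : fieldType) (w : L -> int) : Prop :=
  [/\ (forall x y : L, x != 0 -> y != 0 -> w (x * y) = w x + w y),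
      (forall x y : L, x != 0 -> y != 0 -> x + y != 0 ->
         Num.min (w x) (w y) <= w (x + y))
    & exists x : L, x != 0 /\ w x = 1].

(* w restricted to k equals e * v_P  (v_P(f) = exponent of P in f) *)
Definition lies_over (F : finFieldType) (L : fieldExtType (ratfun F))
    (P : {poly F}) (w : L -> int) (e : nat) : Prop :=
  forall (f : {poly F}) (m : nat), f != 0 -> P ^+ m %| f -> ~~ (P ^+ m.+1 %| f) ->
    w ((tofrac f)%:A) = (e * m)%:Z.

Definition ramified_at (F : finFieldType) (L : fieldExtType (ratfun F))
    (P : {poly F}) : Prop :=
  exists (w : L -> int) (e : nat), [/\ dval w, lies_over P w e & (1 < e)%N].

(* Main.v *)
(**
Let [s] generate the Galois group. The vector [1] of [W_n(L)] has trace [p^n * 1 = 0],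
so additive Hilbert 90, applied one component at a time, gives [y] with [s y = y + 1].
Then [F y - y] is fixed by [s], hence lies in [W_n(k)]; since [1] has order exactly [p^n],
no nontrivial automorphism fixes [y], and [k(y) = L].

Replacing [y] by [y + z] with [z] in [W_n(k)] changes [F y - y] by [F z - z]. Going up
through the components, the [m]-th one only has to be corrected by [a^p - a] with [a] in
[k], and the residue fields being perfect, partial fractions bring it to the stated form,
a priori with poles at arbitrary primes. At an unramified prime [Q] the normalized
valuation extends to some [w] on [L] with index one; inductively the lower components of
[y] are [w]-integral, so a pole of order [e] at [Q] in the [m]-th component would force
[p * w (y_m) = - e], which is impossible when [p] does not divide [e].
*)

Require Import Defs.
From HB Require Import structures.
From mathcomp Require Import all_boot all_order all_algebra all_fingroup all_solvable all_field.
From mathcomp Require Import fraction mpoly ring zify.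
From mathcomp Require boolp classical_sets.
Set Implicit Arguments. Unset Strict Implicit. Unset Printing Implicit Defensive.
Import Order.TTheory GRing.Theory Num.Theory.
Local Open Scope ring_scope.

(** * Ghost components and Witt vectors *)

(** The Witt operations are given by rational polynomials, of whose coefficients [witt_op] keeps
    only the numerators. Nothing can be said about them until these coefficients are known to be
    integers, which follows from Dwork's congruences. The group laws are then proved over rings
    without p-torsion, where ghost components determine a vector, and carried down by a ring
    morphism.

    One fact drives every induction on components: entry m of a sum is the sum of the two entries m
    plus a polynomial in the lower entries. A vector supported at m thus moves entry m additively
    and leaves the lower entries alone, so that each Witt equation becomes an Artin-Schreier
    equation for a single entry, up to carries that are already under control.

    Ramification is expressed through valuations on L, so a valuation above a given prime Q must be
    produced: a subring maximal among those avoiding Q^-1 is a valuation ring, and the finite degree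
    of L over k makes it discrete. That beta_1 is not of the form a^p - a is read off from s y_1 =
    y_1 + 1. *)

Section Congruence.
Variables (p : nat) (A : comNzRingType).
Hypothesis p_pr : prime p.

Definition eqmodn (d : nat) (a b : A) := exists c, a = b + d%:R * c.

Lemma eqmodn_refl d a : eqmodn d a a.
Proof. by exists 0; rewrite mulr0 addr0. Qed.

Lemma eqmodn_sym d a b : eqmodn d a b -> eqmodn d b a.
Proof. by case=> c ->; exists (- c); ring. Qed.

Lemma eqmodn_trans d a b c : eqmodn d a b -> eqmodn d b c -> eqmodn d a c.
Proof. by case=> u -> [v ->]; exists (u + v); ring. Qed.

Lemma eqmodnD d a b a' b' :
  eqmodn d a b -> eqmodn d a' b' -> eqmodn d (a + a') (b + b').
Proof. by case=> u -> [v ->]; exists (u + v); ring. Qed.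

Lemma eqmodnN d a b : eqmodn d a b -> eqmodn d (- a) (- b).
Proof. by case=> u ->; exists (- u); ring. Qed.

Lemma eqmodnM d a b a' b' :
  eqmodn d a b -> eqmodn d a' b' -> eqmodn d (a * a') (b * b').
Proof.
by case=> u -> [v ->]; exists (u * b' + b * v + d%:R * u * v); ring.
Qed.

Lemma eqmodn_scale d e a b : eqmodn e a b -> eqmodn (d * e) (d%:R * a) (d%:R * b).
Proof. by case=> c ->; exists c; rewrite natrM; ring. Qed.

Lemma eqmodn_sum d n (f g : 'I_n -> A) :
  (forall i, eqmodn d (f i) (g i)) -> eqmodn d (\sum_i f i) (\sum_i g i).
Proof.
move=> fg; elim/big_ind2: _ => //; first exact: eqmodn_refl.
by move=> a b a' b'; apply: eqmodnD.
Qed.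

Lemma frobenius_mod (a b : A) : eqmodn p ((a + b) ^+ p) (a ^+ p + b ^+ p).
Proof.
case: p p_pr => // q q_pr; rewrite exprDn big_ord_recl big_ord_recr /=.
rewrite /bump /= !add1n -/(bump 0 _).
rewrite subn0 subnn !bin0 binn !expr0 mulr1 mul1r !mulr1n.
suff [c ->] : exists c, \sum_(i < q)
   a ^+ (q.+1 - bump 0 i) * b ^+ bump 0 i *+ 'C(q.+1, bump 0 i) = q.+1%:R * c :> A.
  by exists c; ring.
exists (\sum_(i < q) a ^+ (q.+1 - bump 0 i) * b ^+ bump 0 i *+
  ('C(q.+1, bump 0 i) %/ q.+1)).
rewrite mulr_sumr; apply: eq_bigr => i _; rewrite mulr_natl -mulrnA divnK //.
by rewrite prime_dvd_bin // /bump /= add1n ltnS ltn_ord.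
Qed.

(** Put a = b + p^(k+1) c. In the binomial expansion the term of index j > 0 carries p^((k+1)j) C(p,
    j): for j < p the binomial coefficient supplies the missing factor p, and for j = p one has
    (k+1)p >= k+2. *)
Lemma eqmodnXp k a b :
  eqmodn (p ^ k.+1) a b -> eqmodn (p ^ k.+2) (a ^+ p) (b ^+ p).
Proof.
case=> c ->; rewrite exprDn big_ord_recl /= subn0 expr0 mulr1 bin0 mulr1n.
apply: (@eqmodn_trans _ _ (b ^+ p + 0)); last by rewrite addr0; apply: eqmodn_refl.
apply: eqmodnD; first exact: eqmodn_refl.
apply: (@eqmodn_trans _ _ (\sum_(i < p) 0)); last first.
  by rewrite big1 //; apply: eqmodn_refl.
apply: eqmodn_sum => i; rewrite /bump /= add1n exprMn -natrX -mulr_natr.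
have /dvdnP[q qE] : (p ^ k.+2 %| (p ^ k.+1) ^ i.+1 * 'C(p, i.+1))%N.
  have [->|ni] := eqVneq i.+1 p.
    by rewrite binn muln1 -expnM dvdn_exp2l // -addn1; have := prime_gt1 p_pr; nia.
  have -> : (p ^ k.+2 = p ^ k.+1 * p)%N by rewrite -expnSr.
  apply: dvdn_mul; first by rewrite [(_ ^ i.+1)%N]expnS dvdn_mulr.
  by apply: prime_dvd_bin; rewrite // [(i.+1 < p)%N]ltn_neqAle ni ltn_ord.
exists (b ^+ (p - i.+1) * c ^+ i.+1 * q%:R); rewrite add0r.
transitivity (b ^+ (p - i.+1) * c ^+ i.+1 * ((p ^ k.+1) ^ i.+1 * 'C(p, i.+1))%:R).
  by rewrite natrM; ring.
by rewrite qE natrM; ring.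
Qed.

Lemma eqmodnXpn k a b :
  eqmodn p a b -> eqmodn (p ^ k.+1) (a ^+ (p ^ k)) (b ^+ (p ^ k)).
Proof.
move=> ab; elim: k => [|k IH]; first by rewrite !expn1.
by rewrite [X in _ ^+ X]expnSr [X in eqmodn _ _ (_ ^+ X)]expnSr !exprM; apply: eqmodnXp.
Qed.

End Congruence.

(** * Ghost components over a ring with a lift of Frobenius *)

Section Ghost.
Variables (p : nat) (A : comNzRingType).
Hypothesis p_pr : prime p.

Definition wghost (x : nat -> A) (m : nat) : A :=
  \sum_(i < m.+1) (p ^ i)%:R * x i ^+ (p ^ (m - i)).

Lemma wghostS x m :
  wghost x m = \sum_(i < m) (p ^ i)%:R * x i ^+ (p ^ (m - i)) + (p ^ m)%:R * x m.
Proof. by rewrite /wghost big_ord_recr /= subnn expn0 expr1. Qed.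

Lemma wghost_ext x y m : (forall i, (i <= m)%N -> x i = y i) ->
  wghost x m = wghost y m.
Proof. by move=> xy; apply: eq_bigr => i _; rewrite xy // -ltnS. Qed.

Section FrobeniusLift.
Variable phi : {rmorphism A -> A}.
Hypothesis phiP : forall a, eqmodn p (phi a) (a ^+ p).

(** Since phi(x_i) and x_i^p agree modulo p, their p^(m-i)-th powers agree modulo p^(m-i+1); the
    coefficient p^i makes up the rest. *)
Lemma wghost_lower_mod (x : nat -> A) m :
  eqmodn (p ^ m.+1) (\sum_(i < m.+1) (p ^ i)%:R * x i ^+ (p ^ (m.+1 - i)))
    (phi (wghost x m)).
Proof.
rewrite rmorph_sum; apply: eqmodn_sum => i /=.
rewrite rmorphM rmorph_nat rmorphXn /=.
have im : (i <= m)%N by rewrite -ltnS.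
rewrite subSn // [(p ^ (m - i).+1)%N]expnS exprM.
have -> : (p ^ m.+1 = p ^ i * p ^ (m - i).+1)%N by rewrite -expnD; congr expn; lia.
by apply: eqmodn_scale; apply: eqmodnXpn => //; apply: eqmodn_sym.
Qed.

(** The necessary half of Dwork's criterion. *)
Lemma wghost_mod (x : nat -> A) m : eqmodn (p ^ m.+1) (wghost x m.+1) (phi (wghost x m)).
Proof.
rewrite wghostS; apply: eqmodn_trans (wghost_lower_mod x m).
by exists (x m.+1).
Qed.

(* Dwork's criterion for a sequence to be a sequence of ghost components. *)
Lemma dwork (w : nat -> A) m :
  (forall j, eqmodn (p ^ j.+1) (w j.+1) (phi (w j))) ->
  exists2 s : seq A, size s = m & forall j, (j < m)%N -> wghost (nth 0 s) j = w j.
Proof.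
move=> wP; elim: m => [|m [s sz sP]]; first by exists [::].
(* Solvability of ghost equation m: [w m] and the sum of the known terms are both congruent to
   phi(w_(m-1)) modulo p^m, so their difference is p^m times the next component. *)
have [c cP] : exists c, w m =
    \sum_(i < m) (p ^ i)%:R * nth 0 s i ^+ (p ^ (m - i)) + (p ^ m)%:R * c.
  case: m sz sP => [|m] sz sP; first by exists (w 0); rewrite big_ord0 expn0; ring.
  apply: eqmodn_trans (wP m) _; rewrite -sP //.
  exact/eqmodn_sym/wghost_lower_mod.
exists (rcons s c); first by rewrite size_rcons sz.
have low j : (j < m)%N -> nth 0 (rcons s c) j = nth 0 s j.
  by move=> jm; rewrite nth_rcons sz jm.
move=> j; rewrite ltnS leq_eqVlt => /orP[/eqP->|jm]; last first.
  by rewrite -sP //; apply: wghost_ext => i ij; apply: low; apply: leq_ltn_trans jm.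
rewrite wghostS cP nth_rcons sz ltnn eqxx; congr (_ + _).
by apply: eq_bigr => i _; rewrite low.
Qed.

End FrobeniusLift.

Section TorsionFree.
Hypothesis tf : forall a : A, p%:R * a = 0 -> a = 0.

Lemma natrX_torsion_free k (a : A) : (p ^ k)%:R * a = 0 -> a = 0.
Proof.
by elim: k => [|k IH]; rewrite ?mul1r // expnS natrM -mulrA => /tf.
Qed.

Lemma natrX_inj k (a b : A) : (p ^ k)%:R * a = (p ^ k)%:R * b -> a = b.
Proof.
move=> ab; apply/eqP; rewrite -subr_eq0; apply/eqP/(@natrX_torsion_free k).
by rewrite mulrBr ab subrr.
Qed.

(** The ghost equations are triangular, and their diagonal coefficients p^j can be cancelled. *)
Lemma wghost_inj m x y : (forall j, (j < m)%N -> wghost x j = wghost y j) ->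
  forall j, (j < m)%N -> x j = y j.
Proof.
move=> xy; elim/ltn_ind => j IH jm; apply: (@natrX_inj j).
have := xy j jm; rewrite !wghostS (eq_bigr (fun i : 'I_j =>
  (p ^ i)%:R * y i ^+ (p ^ (j - i)))) => [/addrI //|i _].
by rewrite IH // (ltn_trans _ jm).
Qed.

(** If the lower entries agree modulo p, their contributions to ghost component j agree modulo
    p^(j+1). Subtracting them leaves p^j times the difference of the entries j, and p^j cancels. *)
Lemma wghost_mod_inj m x y :
  (forall j, (j < m)%N -> eqmodn (p ^ j.+1) (wghost x j) (wghost y j)) ->
  forall j, (j < m)%N -> eqmodn p (x j) (y j).
Proof.
move=> xy; elim/ltn_ind => j IH jm.
have := xy j jm; rewrite !wghostS.
set s := \sum_(i < j) _; set t := \sum_(i < j) _ => h.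
have st : eqmodn (p ^ j.+1) s t.
  apply: eqmodn_sum => i.
  have -> : (p ^ j.+1 = p ^ i * p ^ (j - i).+1)%N.
    by rewrite -expnD; congr expn; have := ltn_ord i; lia.
  apply: eqmodn_scale; apply: eqmodnXpn => //; apply: IH => //.
  exact: ltn_trans jm.
have := eqmodnD (eqmodnN st) h.
rewrite !addKr => -[c]; rewrite expnSr natrM -mulrA -mulrDr => /natrX_inj e.
by exists c.
Qed.

End TorsionFree.
End Ghost.

(** * The lift of Frobenius to integer polynomials *)

Section FrobeniusLiftMpoly.
Variables (p N : nat).
Hypothesis p_pr : prime p.

Lemma fermat_int (c : int) : eqmodn p c (c ^+ p).
Proof.
have p0 : (p == 0)%N = false by rewrite gtn_eqF ?prime_gt0.
have nat_case (k : nat) : eqmodn p (k%:R : int) (k%:R ^+ p).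
  elim: k => [|k IH].
    by rewrite expr0n gtn_eqF ?prime_gt0 //; apply: eqmodn_refl.
  rewrite -addn1 natrD; apply: eqmodn_trans (eqmodn_sym (frobenius_mod p_pr _ _)).
  by apply: eqmodnD => //; rewrite expr1n; apply: eqmodn_refl.
case: c => k; rewrite ?NegzE -?[(k : int)]natz -?[(k.+1 : int)]natz //.
apply: eqmodn_trans (eqmodnN (nat_case _)) _.
(* Negative integers: k+1 and -(k+1) add up to 0, so their p-th powers add up to 0 modulo p,
   whatever the parity of p. *)
have := frobenius_mod p_pr (k.+1%:R : int) (- k.+1%:R).
rewrite subrr expr0n p0 => -[c e].
by exists c; apply: (addrI (k.+1%:R ^+ p)); rewrite subrr addrA.
Qed.

Definition mpoly_frob : {mpoly int[N]} -> {mpoly int[N]} :=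
  mmap (@mpolyC N int) (fun i => 'X_i ^+ p).
HB.instance Definition _ := GRing.RMorphism.copy mpoly_frob
  (mmap (@mpolyC N int) (fun i => 'X_i ^+ p)).

Lemma mpoly_frobP (f : {mpoly int[N]}) : eqmodn p (mpoly_frob f) (f ^+ p).
Proof.
elim/mpolyind: f => [|c m f _ _ IH].
  by rewrite rmorph0 expr0n gtn_eqF ?prime_gt0 //; apply: eqmodn_refl.
rewrite rmorphD; apply: eqmodn_trans (eqmodn_sym (frobenius_mod p_pr _ _)).
apply: eqmodnD => //; rewrite -mul_mpolyC rmorphM exprMn; apply: eqmodnM.
  rewrite -[X in eqmodn _ X _]/(mpoly_frob c%:MP).
  have -> : mpoly_frob c%:MP = c%:MP :> {mpoly int[N]} by exact: mmapC.
  rewrite -rmorphXn /=; have [d e] := fermat_int c.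
  by exists d%:MP; rewrite [in LHS]e rmorphD rmorphM rmorph_nat.
rewrite -[X in eqmodn _ X _]/(mpoly_frob 'X_[m]).
have -> : mpoly_frob 'X_[m] = mmap1 (fun i => 'X_i ^+ p) m :> {mpoly int[N]}.
  by exact: mmapX.
rewrite (mpolyXE_id _ m) -prodrXl /mmap1.
rewrite (eq_bigr (fun i => ('X_i ^+ m i) ^+ p)); first exact: eqmodn_refl.
by move=> i _; rewrite -!exprM mulnC.
Qed.

End FrobeniusLiftMpoly.

(** A Boolean in place of an arbitrary operation lets addition and subtraction share every proof;
    both values unfold to the operations used in [witt_add] and [witt_sub]. *)
Definition addsub (A : zmodType) (b : bool) (u v : A) : A :=
  if b then u - v else u + v.

Lemma addsubE (A B : zmodType) (f : {additive A -> B}) b u v :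
  f (addsub b u v) = addsub b (f u) (f v).
Proof. by case: b; rewrite /= ?raddfB ?raddfD. Qed.

Definition ffun_ext (n : nat) (A : nmodType) (x : {ffun 'I_n -> A}) (i : nat) : A :=
  if insub i is Some k then x k else 0.

Lemma ffun_extE n (A : nmodType) (x : {ffun 'I_n -> A}) (i : 'I_n) : ffun_ext x i = x i.
Proof. by rewrite /ffun_ext valK. Qed.

Definition ffun_pair (n : nat) (A : Type) (x y : {ffun 'I_n -> A}) (j : 'I_(n + n)) : A :=
  match split j with inl a => x a | inr b => y b end.

(** * Integrality of the Witt polynomials *)

Section Integrality.
Variables (p n : nat) (b : bool).
Hypothesis p_pr : prime p.
Local Notation MZ := {mpoly int[n + n]}.

Definition zX : {ffun 'I_n -> MZ} := [ffun i => 'X_(lshift n i)].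
Definition zY : {ffun 'I_n -> MZ} := [ffun i => 'X_(rshift n i)].

(** The ghost components of X and Y satisfy Dwork's congruences for [mpoly_frob], hence so do their
    sums and differences, which are therefore ghost components of an integral sequence. Over Q the
    recursion has only one solution, so this sequence is [witt_polys], and taking numerators in
    [witt_op] loses nothing. *)
Lemma witt_polys_int : exists s : seq MZ,
  witt_polys p (n := n) (addsub b) n = map (map_mpoly intr) s
  /\ forall j, (j < n)%N ->
     wghost p (nth 0 s) j = addsub b (wghost p (ffun_ext zX) j) (wghost p (ffun_ext zY) j).
Proof.
pose w j := addsub b (wghost p (ffun_ext zX) j) (wghost p (ffun_ext zY) j).
have [j|s sz sP] := @dwork p MZ p_pr (mpoly_frob p (N := n + n)) (mpoly_frobP p_pr) w n.
  rewrite /w addsubE /addsub; have ghP := wghost_mod p_pr (mpoly_frobP p_pr).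
  case: (b); last by apply: eqmodnD; apply: ghP.
  by apply: eqmodnD; [|apply: eqmodnN]; apply: ghP.
exists s; split=> //.
have ghX j : (j < n)%N -> map_mpoly intr (wghost p (ffun_ext zX) j) = ghost p (@wX n) j.
  move=> jn; rewrite rmorph_sum; apply: eq_bigr => i _.
  rewrite rmorphM rmorph_nat /= [map_mpoly _ (_ ^+ _)]rmorphXn; congr (_ * _ ^+ _).
  by rewrite /ffun_ext /wX; case: insubP => [k _ _|_]; rewrite ?rmorph0 ?ffunE /= ?map_mpolyX.
have ghY j : (j < n)%N -> map_mpoly intr (wghost p (ffun_ext zY) j) = ghost p (@wY n) j.
  move=> jn; rewrite rmorph_sum; apply: eq_bigr => i _.
  rewrite rmorphM rmorph_nat /= [map_mpoly _ (_ ^+ _)]rmorphXn; congr (_ * _ ^+ _).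
  by rewrite /ffun_ext /wY; case: insubP => [k _ _|_]; rewrite ?rmorph0 ?ffunE /= ?map_mpolyX.
suff tk m : (m <= n)%N ->
    witt_polys p (n := n) (addsub b) m = map (map_mpoly intr) (take m s).
  by rewrite tk // take_oversize // sz.
elim: m => [_|m IH mn]; first by rewrite take0.
rewrite (take_nth 0) ?sz // map_rcons /= (IH (ltnW mn)); congr rcons.
set T := \sum_(i < m) _.
have h : addsub b (ghost p (@wX n) m) (ghost p (@wY n) m) =
    T + (p ^ m)%:R * map_mpoly intr (nth 0 s m).
  rewrite -ghX // -ghY //.
  transitivity (map_mpoly intr (w m) : {mpoly rat[n + n]}).
    by apply/esym; apply: (@addsubE _ _ (@map_mpoly (n + n) int rat intr)).
  rewrite -sP // wghostS rmorphD rmorphM rmorph_nat; congr (_ + _).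
  rewrite rmorph_sum; apply: eq_bigr => i _.
  rewrite rmorphM rmorph_nat /= [map_mpoly _ (_ ^+ _)]rmorphXn; congr (_ * _ ^+ _).
  by rewrite (nth_map 0) ?nth_take // size_take sz mn.
rewrite h [T + _]addrC addrK mulr_natl -scaler_nat scalerA mulVf ?scale1r //.
by rewrite pnatr_eq0 expn_eq0 -leqn0 leqNgt prime_gt0.
Qed.

End Integrality.

Lemma mmap_numq_intr (N : nat) (R : comNzRingType) (h : 'I_N -> R) (f : {mpoly int[N]}) :
  mmap (fun c : rat => (numq c)%:~R) h (map_mpoly intr f) = mmap intr h f.
Proof.
rewrite /mmap (perm_big _ (msupp_map_mpoly f (@intr_inj rat))) /=.
by apply: eq_bigr => m _; rewrite mcoeff_map_mpoly numq_int.
Qed.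

Lemma rmorph_mmap_int N (R S : comNzRingType) (phi : {rmorphism R -> S})
    (h : 'I_N -> R) (f : {mpoly int[N]}) :
  phi (mmap intr h f) = mmap intr (phi \o h) f.
Proof.
rewrite /mmap rmorph_sum; apply: eq_bigr => m _.
rewrite rmorphM rmorph_int /mmap1 rmorph_prod; congr (_ * _).
by apply: eq_bigr => i _; rewrite rmorphXn.
Qed.

Definition ffun_map (n : nat) (A B : Type) (f : A -> B) (x : {ffun 'I_n -> A}) :
  {ffun 'I_n -> B} := [ffun i => f (x i)].

Lemma ffun_mapE n (A B : Type) (f : A -> B) (x : {ffun 'I_n -> A}) i :
  ffun_map f x i = f (x i).
Proof. exact: ffunE. Qed.

(** One variable for each entry of the given vectors: a polynomial ring over Z in finitely many
    variables has no p-torsion, and evaluation reaches all these entries, though not necessarily all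
    of R. *)
Lemma torsion_free_lift (p n : nat) (R : comNzRingType) (xs : seq {ffun 'I_n -> R}) :
  prime p -> exists (A : comNzRingType) (phi : {rmorphism A -> R}),
    (forall a : A, p%:R * a = 0 -> a = 0)
    /\ forall x, x \in xs -> exists X : {ffun 'I_n -> A}, x = ffun_map phi X.
Proof.
move=> p_pr; pose s := flatten [seq codom x | x : {ffun 'I_n -> R} <- xs].
pose h (i : 'I_(size s)) : R := nth 0 s i.
exists {mpoly int[size s]}, (mmap intr h); split.
  move=> a /mpolyP e; apply/mpolyP => m; have := e m.
  rewrite mulr_natl mcoeffMn mcoeff0 => /eqP.
  by rewrite mulrn_eq0 gtn_eqF ?prime_gt0 //= => /eqP.
move=> x x_xs.
have ix i : (index (x i) s < size s)%N.
  rewrite index_mem; apply/flattenP; exists (codom x); last exact: codom_f.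
  by apply/mapP; exists x.
exists [ffun i => 'X_(Ordinal (ix i))]; apply/ffunP => i; rewrite !ffunE /=.
by rewrite mmapX mmap1U /h /= nth_index // -index_mem.
Qed.

Lemma size_witt_polys p n (g : {mpoly rat[n + n]} -> {mpoly rat[n + n]} -> {mpoly rat[n + n]}) m :
  size (witt_polys p g m) = m.
Proof. by elim: m => //= m IH; rewrite size_rcons IH. Qed.

(** * Group laws of Witt vectors *)

Section WittOp.
Variables (p n : nat).
Hypothesis p_pr : prime p.

Definition wop (b : bool) (R : comNzRingType) (x y : {ffun 'I_n -> R}) :=
  @witt_op p n (addsub b) R x y.

(** The same integer polynomials serve for all rings; functoriality and the ghost identities over
    any ring are obtained by evaluating them. *)
Lemma wop_mmap b : exists s : 'I_n -> {mpoly int[n + n]},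
  (forall (R : comNzRingType) (x y : {ffun 'I_n -> R}) i,
     wop b x y i = mmap intr (ffun_pair x y) (s i))
  /\ forall j, (j < n)%N -> wghost p (ffun_ext (finfun s)) j =
     addsub b (wghost p (ffun_ext (zX n)) j) (wghost p (ffun_ext (zY n)) j).
Proof.
have [s [sE sP]] := witt_polys_int n b p_pr.
exists (fun i => nth 0 s i); split.
  move=> R x y i; rewrite /wop /witt_op ffunE sE.
  have sz : size s = n.
    rewrite -(size_map (map_mpoly intr : _ -> {mpoly rat[n + n]})) -sE.
    exact: size_witt_polys.
  by rewrite (nth_map 0) ?sz // mmap_numq_intr.
move=> j jn; apply: etrans (sP j jn); apply: wghost_ext => i ij.
have lt_in : (i < n)%N by apply: leq_ltn_trans jn.
by rewrite (ffun_extE _ (Ordinal lt_in)) ffunE.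
Qed.

(** Meant for valuation rings: integer polynomials in integral entries stay integral. *)
Lemma wop_closed b (R : comNzRingType) (S : R -> Prop) (x y : {ffun 'I_n -> R}) i :
  S 1 -> (forall u v, S u -> S v -> S (u - v)) -> (forall u v, S u -> S v -> S (u * v)) ->
  (forall j, S (x j)) -> (forall j, S (y j)) -> S (wop b x y i).
Proof.
move=> S1 SB SM Sx Sy; have [s [-> _]] := wop_mmap b.
have S0 : S 0 by rewrite -(subrr 1); apply: SB.
have SN u : S u -> S (- u) by move=> Su; rewrite -[- u]add0r; apply: SB.
have SD u v : S u -> S v -> S (u + v).
  by move=> Su Sv; rewrite -[v]opprK; apply: SB => //; apply: SN.
have SX u k : S u -> S (u ^+ k).
  by move=> Su; elim: k => [|k IH] //; rewrite exprS; apply: SM.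
have Sn k : S k%:R by elim: k => [|k IH] //; rewrite -addn1 natrD; apply: SD.
have Sz (z : int) : S z%:~R by case: z => k; [exact: Sn|rewrite NegzE mulrNz; apply/SN/Sn].
rewrite /mmap; apply: (big_ind S) => [||m _]; [exact: S0|exact: SD|apply: (SM) => //].
rewrite /mmap1; apply: (big_ind S) => [||j _]; [exact: S1|exact: SM|].
apply: SX; rewrite /ffun_pair.
by case: split.
Qed.

Lemma wop_map b (R S : comNzRingType) (phi : {rmorphism R -> S}) x y :
  wop b (ffun_map phi x) (ffun_map phi y) = ffun_map phi (wop b x y).
Proof.
have [s [sE _]] := wop_mmap b; apply/ffunP => i; rewrite ffun_mapE !sE rmorph_mmap_int.
apply: eq_bigr => m _; congr (_ * _); apply: mmap1_eq => j /=.
by rewrite /ffun_pair; case: split => k; rewrite ffunE.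
Qed.

Lemma wghost_wop b (R : comNzRingType) (x y : {ffun 'I_n -> R}) j : (j < n)%N ->
  wghost p (ffun_ext (wop b x y)) j =
  addsub b (wghost p (ffun_ext x) j) (wghost p (ffun_ext y) j).
Proof.
move=> jn; have [s [sE /(_ j jn) sP]] := wop_mmap b.
have [ev evE] : exists ev : {rmorphism {mpoly int[n + n]} -> R},
    forall f, ev f = mmap intr (ffun_pair x y) f.
  by exists (mmap intr (ffun_pair x y)).
have gh_ev (z : {ffun 'I_n -> {mpoly int[n + n]}}) (t : {ffun 'I_n -> R}) :
    (forall i, ev (z i) = t i) -> ev (wghost p (ffun_ext z) j) = wghost p (ffun_ext t) j.
  move=> zt; rewrite rmorph_sum; apply: eq_bigr => i _.
  rewrite rmorphM rmorph_nat [ev (_ ^+ _)]rmorphXn; congr (_ * _ ^+ _); rewrite /ffun_ext.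
  by case: insubP => [k _ _|_]; rewrite ?zt ?rmorph0.
apply: etrans (esym (gh_ev (finfun s) (wop b x y) _)) _ => [i|].
  by rewrite ffunE evE sE.
apply: etrans (congr1 ev sP) _; apply: etrans (addsubE ev b _ _) _.
congr addsub; apply: gh_ev => i; rewrite ffunE evE mmapX mmap1U /ffun_pair.
  case: splitP => [k /= e|k /= e]; first by congr (x _); apply/val_inj.
  by have := ltn_ord i; rewrite e; lia.
case: splitP => [k /= e|k /= /addnI e]; first by have := ltn_ord k; rewrite -e; lia.
by congr (y _); apply/val_inj.
Qed.

Lemma wghost_ffun_inj (A : comNzRingType) (x y : {ffun 'I_n -> A}) :
  (forall a : A, p%:R * a = 0 -> a = 0) ->
  (forall j, (j < n)%N -> wghost p (ffun_ext x) j = wghost p (ffun_ext y) j) -> x = y.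
Proof.
move=> tf xy; apply/ffunP => i; rewrite -!ffun_extE.
exact: (wghost_inj tf xy (ltn_ord i)).
Qed.

Lemma wghost0 (R : comNzRingType) j :
  wghost p (ffun_ext ([ffun=> 0] : {ffun 'I_n -> R})) j = 0.
Proof.
rewrite /wghost big1 // => i _; rewrite /ffun_ext.
have -> : (if insub (val i) is Some k then ([ffun=> 0] : {ffun 'I_n -> R}) k else 0) = 0.
  by case: insubP => [k _ _|_]; rewrite ?ffunE.
by rewrite expr0n gtn_eqF ?mulr0 // expn_gt0 prime_gt0.
Qed.

Lemma ffun_map0 (R S : comNzRingType) (phi : {rmorphism R -> S}) :
  ffun_map phi [ffun=> 0] = [ffun=> 0] :> {ffun 'I_n -> S}.
Proof. by apply/ffunP => i; rewrite !ffunE rmorph0. Qed.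

Section Laws.
Variable R : comNzRingType.
Implicit Types x y z : {ffun 'I_n -> R}.
Local Notation zero := ([ffun=> 0] : {ffun 'I_n -> R}).

(** Like the laws that follow, it is checked on a torsion-free lift, where ghost components are
    injective and turn it into the same law for the addition of A. *)
Lemma waddA x y z : wop false x (wop false y z) = wop false (wop false x y) z.
Proof.
have [A [phi [tf lift]]] := torsion_free_lift [:: x; y; z] p_pr.
have [|X ->] := lift x; first by rewrite !inE eqxx.
have [|Y ->] := lift y; first by rewrite !inE eqxx orbT.
have [|Z ->] := lift z; first by rewrite !inE eqxx !orbT.
rewrite !wop_map; congr ffun_map; apply: wghost_ffun_inj => // j jn.
by rewrite !wghost_wop //= addrA.
Qed.

Lemma waddC x y : wop false x y = wop false y x.
Proof.
have [A [phi [tf lift]]] := torsion_free_lift [:: x; y] p_pr.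
have [|X ->] := lift x; first by rewrite !inE eqxx.
have [|Y ->] := lift y; first by rewrite !inE eqxx orbT.
rewrite !wop_map; congr ffun_map; apply: wghost_ffun_inj => // j jn.
by rewrite !wghost_wop //= addrC.
Qed.

Lemma wadd0 x : wop false zero x = x.
Proof.
have [A [phi [tf lift]]] := torsion_free_lift [:: x] p_pr.
have [|X ->] := lift x; first by rewrite !inE eqxx.
rewrite -(ffun_map0 phi) !wop_map; congr ffun_map; apply: wghost_ffun_inj => // j jn.
by rewrite !wghost_wop //= wghost0 add0r.
Qed.

Lemma waddN x : wop false (wop true zero x) x = zero.
Proof.
have [A [phi [tf lift]]] := torsion_free_lift [:: x] p_pr.
have [|X ->] := lift x; first by rewrite !inE eqxx.
rewrite -(ffun_map0 phi) !wop_map; congr ffun_map; apply: wghost_ffun_inj => // j jn.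
by rewrite !wghost_wop //= wghost0 sub0r addNr.
Qed.

Lemma wsubE x y : wop true x y = wop false x (wop true zero y).
Proof.
have [A [phi [tf lift]]] := torsion_free_lift [:: x; y] p_pr.
have [|X ->] := lift x; first by rewrite !inE eqxx.
have [|Y ->] := lift y; first by rewrite !inE eqxx orbT.
rewrite -(ffun_map0 phi) !wop_map; congr ffun_map; apply: wghost_ffun_inj => // j jn.
by rewrite !wghost_wop //= wghost0 sub0r.
Qed.

(** The carry into entry m depends only on the lower entries, so it cancels here. On a torsion-free
    lift, vectors that agree below m have m-th ghost components differing by p^m times the
    difference of their entries m, and p^m can be divided out. *)
Lemma wop_diff b x x' y y' (m : 'I_n) :
  (forall i : 'I_n, (i < m)%N -> x i = x' i) ->
  (forall i : 'I_n, (i < m)%N -> y i = y' i) ->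
  wop b x y m - wop b x' y' m = addsub b (x m - x' m) (y m - y' m).
Proof.
have [A [phi [tf lift]]] := torsion_free_lift [:: x; x'; y; y'] p_pr.
have [|X xE] := lift x; first by rewrite !inE eqxx.
have [|X1 x'E] := lift x'; first by rewrite !inE eqxx !orbT.
have [|Y yE] := lift y; first by rewrite !inE eqxx !orbT.
have [|Y1 y'E] := lift y'; first by rewrite !inE eqxx !orbT.
move=> xx' yy'.
(* The lifts of x and x' are found independently; taking the low entries of X in both makes them
   agree below m before reduction as well. *)
pose X' := [ffun i : 'I_n => if (i < m)%N then X i else X1 i].
pose Y' := [ffun i : 'I_n => if (i < m)%N then Y i else Y1 i].
have {}x'E : x' = ffun_map phi X'.
  apply/ffunP => i; rewrite !ffunE; case: ifP => im.
    by rewrite -xx' // xE ffunE.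
  by rewrite x'E ffunE.
have {}y'E : y' = ffun_map phi Y'.
  apply/ffunP => i; rewrite !ffunE; case: ifP => im.
    by rewrite -yy' // yE ffunE.
  by rewrite y'E ffunE.
have agree (Z Z' : {ffun 'I_n -> A}) : (forall i : 'I_n, (i < m)%N -> Z i = Z' i) ->
    forall i, (i < m)%N -> ffun_ext Z i = ffun_ext Z' i.
  move=> e i im; have lt_in : (i < n)%N by apply: ltn_trans (ltn_ord m).
  by rewrite !(ffun_extE _ (Ordinal lt_in)) e.
have XX' := agree X X' _; have YY' := agree Y Y' _.
have {}XX' i : (i < m)%N -> ffun_ext X i = ffun_ext X' i.
  by apply: XX' => k km; rewrite ffunE km.
have {}YY' i : (i < m)%N -> ffun_ext Y i = ffun_ext Y' i.
  by apply: YY' => k km; rewrite ffunE km.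
have low i : (i < m)%N -> ffun_ext (wop b X Y) i = ffun_ext (wop b X' Y') i.
  apply: (wghost_inj tf) => j jm; have jn : (j < n)%N := ltn_trans jm (ltn_ord m).
  rewrite !wghost_wop //; congr addsub; apply: wghost_ext => k kj.
    by rewrite XX' // (leq_ltn_trans kj).
  by rewrite YY' // (leq_ltn_trans kj).
have ghd (Z Z' : {ffun 'I_n -> A}) :
   (forall i, (i < m)%N -> ffun_ext Z i = ffun_ext Z' i) ->
   wghost p (ffun_ext Z) m - wghost p (ffun_ext Z') m = (p ^ m)%:R * (Z m - Z' m).
  move=> e; rewrite !wghostS !ffun_extE.
  rewrite (eq_bigr (fun i : 'I_m => (p ^ i)%:R * ffun_ext Z' i ^+ (p ^ (m - i)))).
    by ring.
  by move=> i _; rewrite e.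
have top : wop b X Y m - wop b X' Y' m = addsub b (X m - X' m) (Y m - Y' m).
  apply: (@natrX_inj p A tf m); rewrite -ghd // !wghost_wop //.
  transitivity (addsub b ((p ^ m)%:R * (X m - X' m)) ((p ^ m)%:R * (Y m - Y' m))).
    by rewrite -!ghd // /addsub; case: (b); ring.
  by rewrite /addsub; case: (b); ring.
rewrite xE x'E yE y'E !wop_map !ffun_mapE -rmorphB top (addsubE phi).
by rewrite /= !rmorphB.
Qed.

End Laws.
End WittOp.

(* The type carries the proof that [p] is prime because the group laws need it. *)
Definition witt (p : nat) (p_pr : prime p) (n : nat) (R : comNzRingType) :=
  {ffun 'I_n -> R}.

(** * The additive group of Witt vectors and multiples of its unit vector *)

Section WittGroup.
Variables (p : nat) (p_pr : prime p) (n : nat).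

HB.instance Definition _ (R : comNzRingType) := Choice.on (witt p_pr n R).
HB.instance Definition _ (R : comNzRingType) :=
  GRing.isZmodule.Build (witt p_pr n R) (@waddA p n p_pr R) (@waddC p n p_pr R)
   (@wadd0 p n p_pr R) (@waddN p n p_pr R).

Local Notation W := (witt p_pr n).

Lemma wittDE (R : comNzRingType) (x y : W R) : x + y = wop p false x y :> {ffun _ -> _}.
Proof. by []. Qed.

Lemma wittBE (R : comNzRingType) (x y : W R) : x - y = wop p true x y :> {ffun _ -> _}.
Proof. by rewrite wsubE. Qed.

Definition witt_map (R S : comNzRingType) (phi : {rmorphism R -> S}) (x : W R) : W S :=
  ffun_map phi x.

Lemma witt_map_is_additive (R S : comNzRingType) (phi : {rmorphism R -> S}) :
  additive (witt_map phi).
Proof. by move=> x y; rewrite [in RHS]wittBE wop_map // -wittBE. Qed.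

HB.instance Definition _ (R S : comNzRingType) (phi : {rmorphism R -> S}) :=
  GRing.isAdditive.Build (W R) (W S) (witt_map phi) (@witt_map_is_additive R S phi).

Lemma witt_mapE (R S : comNzRingType) (phi : {rmorphism R -> S}) (x : W R) i :
  witt_map phi x i = phi (x i).
Proof. exact: ffun_mapE. Qed.

(** The k-fold Verschiebung of the unit vector. The index is a natural number so that k >= n is
    allowed, where the vector is zero. *)
Definition witt1 k (R : comNzRingType) : W R := [ffun i : 'I_n => (val i == k)%:R].

Lemma witt1_map k (R S : comNzRingType) (phi : {rmorphism R -> S}) :
  witt_map phi (witt1 k R) = witt1 k S.
Proof. by apply/ffunP => i; rewrite witt_mapE !ffunE rmorph_nat. Qed.

Lemma wghost_mulrn (R : comNzRingType) (x : W R) k j : (j < n)%N ->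
  wghost p (ffun_ext (x *+ k)) j = wghost p (ffun_ext x) j *+ k.
Proof.
move=> jn; elim: k => [|k IH]; first by rewrite !mulr0n wghost0.
by rewrite !mulrS wittDE wghost_wop //= IH.
Qed.

Lemma wghost_witt1 k (R : comNzRingType) j : (j < n)%N ->
  wghost p (ffun_ext (witt1 k R)) j = if (k <= j)%N then (p ^ k)%:R else 0.
Proof.
move=> jn; have wE i : (i < j.+1)%N -> ffun_ext (witt1 k R) i = (i == k)%:R.
  move=> ij; have lt_in : (i < n)%N by apply: leq_ltn_trans jn.
  by rewrite (ffun_extE _ (Ordinal lt_in)) ffunE.
have z i : 0 ^+ (p ^ i) = 0 :> R by rewrite expr0n gtn_eqF // expn_gt0 prime_gt0.
case: ifP => [kj|kj]; last first.
  rewrite /wghost big1 // => i _; rewrite wE //; case: eqP => [ik|]; last by rewrite z mulr0.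
  by move: kj; rewrite -ik -ltnS ltn_ord.
rewrite /wghost (bigD1 (Ordinal (kj : (k < j.+1)%N))) //= wE // eqxx expr1n mulr1.
rewrite big1 ?addr0 // => i ik; rewrite wE //; case: eqP => [e|]; last by rewrite z mulr0.
by case/eqP: ik; apply/val_inj.
Qed.

(* In characteristic [p], [p^k] times the unit vector is its [k]-fold Verschiebung: over
   the integers the two sides have ghost components congruent modulo [p^(j+1)]. *)
Lemma witt1_mulrn k (R : comNzRingType) : p \in [pchar R] ->
  witt1 0 R *+ (p ^ k) = witt1 k R.
Proof.
move=> pR; have tf (a : int) : p%:R * a = 0 -> a = 0.
  by move/eqP; rewrite mulf_eq0 pnatr_eq0 gtn_eqF ?prime_gt0 //= => /eqP.
have key j : (j < n)%N ->
    eqmodn p (ffun_ext (witt1 0 int *+ (p ^ k)) j) (ffun_ext (witt1 k int) j).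
  apply: (wghost_mod_inj p_pr tf) => i lt_in.
  rewrite wghost_mulrn // !wghost_witt1 //=; case: leqP => [ki|ik].
    by rewrite expn0; apply: eqmodn_refl.
  exists ((p ^ (k - i.+1))%:R); rewrite expn0 add0r -natrM -expnD subnKC //.
pose phi : {rmorphism int -> R} := intr.
rewrite -(witt1_map 0 phi) -(witt1_map k phi) -raddfMn.
apply/ffunP => i; have [c] := key i (ltn_ord i); rewrite !ffun_extE !witt_mapE => ->.
by rewrite rmorphD rmorphM rmorph_nat (pcharf0 pR) mul0r addr0.
Qed.

End WittGroup.

(** * Extension of discrete valuations *)

Section ValuationRings.
Variable L : fieldType.

Definition is_subring (S : L -> Prop) : Prop :=
  [/\ S 1, (forall x y, S x -> S y -> S (x - y)) & (forall x y, S x -> S y -> S (x * y))].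

Section Subring.
Variable S : L -> Prop.
Hypothesis Sring : is_subring S.

Lemma subring1 : S 1. Proof. by case: Sring. Qed.
Lemma subringB x y : S x -> S y -> S (x - y). Proof. by case: Sring => _ h _; apply: h. Qed.
Lemma subringM x y : S x -> S y -> S (x * y). Proof. by case: Sring => _ _; apply. Qed.
Lemma subring0 : S 0. Proof. by rewrite -(subrr 1); apply: subringB; apply: subring1. Qed.
Lemma subringN x : S x -> S (- x).
Proof. by move=> Sx; rewrite -[- x]add0r; apply: subringB => //; apply: subring0. Qed.
Lemma subringD x y : S x -> S y -> S (x + y).
Proof. by move=> Sx Sy; rewrite -[y]opprK; apply: subringB => //; apply: subringN. Qed.
Lemma subringX x k : S x -> S (x ^+ k).
Proof.
move=> Sx; elim: k => [|k IH]; first exact: subring1.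
by rewrite exprS; apply: subringM.
Qed.
Lemma subring_sum n (f : 'I_n -> L) : (forall i, S (f i)) -> S (\sum_i f i).
Proof. by move=> Sf; apply: (big_ind S) => //; [exact: subring0 | exact: subringD]. Qed.

Lemma subring_extend x :
  is_subring (fun z => exists2 r : {poly L}, (forall i, S r`_i) & z = r.[x]).
Proof.
split.
- exists 1; last by rewrite hornerC.
  by move=> i; rewrite coef1; case: eqP => _; [exact: subring1|exact: subring0].
- move=> _ _ [r Sr ->] [s Ss ->]; exists (r - s); last by rewrite !hornerE.
  by move=> i; rewrite coefB; apply: subringB.
- move=> _ _ [r Sr ->] [s Ss ->]; exists (r * s); last by rewrite hornerM.
  by move=> i; rewrite coefM; apply: subring_sum => j; apply: subringM.
Qed.

End Subring.

Variables (S0 : L -> Prop) (q : L).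
Hypotheses (S0ring : is_subring S0) (S0q : S0 q) (S0Vq : ~ S0 q^-1).

Let q_neq0 : q != 0.
Proof. by apply/eqP => q0; apply: S0Vq; rewrite q0 invr0 -q0. Qed.

(** Keeping q^-1 out forces q to be a nonunit; a maximal ring with this property turns out to be a
    valuation ring. *)
Definition avoids (S : L -> Prop) :=
  [/\ is_subring S, (forall x, S0 x -> S x) & ~ S q^-1].

Lemma maximal_avoiding_subring : exists2 C, avoids C &
  forall B, avoids B -> (forall x, C x -> B x) -> forall x, B x -> C x.
Proof.
(* The empty set is allowed because it is the union of the empty chain. *)
pose P (C : L -> Prop) := (forall x, ~ C x) \/ avoids C.
have [FF FFP FFtot|C [PC Cmax]] := @classical_sets.Zorn_bigcup L P.
  have [[X FX [Xr XS0 XVq]]|nX] := boolp.EM (exists2 X, FF X & avoids X); last first.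
    left=> x [X FX Xx]; case: (FFP X FX) => [/(_ x)//|gX].
    by case: nX; exists X.
  have good Y x : FF Y -> Y x -> avoids Y by move=> FY Yx; case: (FFP Y FY) => [/(_ x)|].
  have both x y : classical_sets.bigcup FF id x -> classical_sets.bigcup FF id y ->
      exists Z, [/\ FF Z, avoids Z, Z x & Z y].
    move=> [Y FY Yx] [Z FZ Zy]; case: (FFtot Y Z FY FZ) => YZ.
      by exists Z; split=> //; [exact: good Zy|exact: YZ].
    by exists Y; split=> //; [exact: good Yx|exact: YZ].
  right; split; first split.
  - by exists X => //; apply: subring1.
  - move=> x y Ux Uy; have [Z [FZ [Zr _ _] Zx Zy]] := both x y Ux Uy.
    by exists Z => //; apply: subringB.
  - move=> x y Ux Uy; have [Z [FZ [Zr _ _] Zx Zy]] := both x y Ux Uy.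
    by exists Z => //; apply: subringM.
  - by move=> x S0x; exists X => //; apply: XS0.
  - by case=> Y FY Yq; case: (good Y _ FY Yq).
have S0good : avoids S0 by split.
case: PC => [C0|gC].
  case: (Cmax S0); last by right.
  split; first by move=> x /C0.
  by move=> /(_ 1 (subring1 S0ring)) /C0.
exists C => // B gB CB x Bx; have [//|nCx] := boolp.EM (C x).
case: (Cmax B); last by right.
by split=> // BC; apply: nCx; apply: BC.
Qed.

Section Maximal.
Variable C : L -> Prop.
Hypothesis Cgood : avoids C.
Hypothesis Cmax : forall B, avoids B -> (forall x, C x -> B x) -> forall x, B x -> C x.

Let Cr : is_subring C. Proof. by case: Cgood. Qed.
Let CS0 x : S0 x -> C x. Proof. by case: Cgood => _ h _; apply: h. Qed.
Let CVq : ~ C q^-1. Proof. by case: Cgood. Qed.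
Let Cq : C q. Proof. exact: CS0. Qed.

Lemma avoiding_one_sub_neq0 b : C b -> 1 - q * b != 0.
Proof.
move=> Cb; apply/eqP => /eqP; rewrite subr_eq0 => /eqP e; apply: CVq.
by rewrite -[q^-1]mulr1 e mulKf.
Qed.

(** Put s = 1 - q b. Inverting s keeps q^-1 out: each power of s has the form 1 - q b' with b' in C,
    so q^-1 s^N = q^-1 - b' lies in C only if q^-1 does. By maximality s^-1 is already in C. *)
Lemma avoiding_one_sub_unit b : C b -> C (1 - q * b)^-1.
Proof.
move=> Cb; set s := 1 - q * b; have s0 : s != 0 := avoiding_one_sub_neq0 Cb.
have Cs : C s by apply: subringB => //; [exact: subring1|exact: subringM].
apply: (Cmax (B := fun x => exists N, C (x * s ^+ N))); last first.
- by exists 1%N; rewrite expr1 mulVf //; exact: subring1.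
- by move=> x Cx; exists 0%N; rewrite mulr1.
split; first split.
- by exists 0%N; rewrite mulr1; exact: subring1.
- move=> x y [N xN] [M yM]; exists (N + M)%N.
  have -> : (x - y) * s ^+ (N + M) = x * s ^+ N * s ^+ M - y * s ^+ M * s ^+ N.
    by rewrite exprD; ring.
  by apply: subringB => //; apply: subringM => //; apply: subringX.
- move=> x y [N xN] [M yM]; exists (N + M)%N.
  have -> : x * y * s ^+ (N + M) = (x * s ^+ N) * (y * s ^+ M) by rewrite exprD; ring.
  exact: subringM.
- by move=> x S0x; exists 0%N; rewrite mulr1; apply: CS0.
- case=> N; have [b' Cb' ->] : exists2 b', C b' & s ^+ N = 1 - q * b'.
    elim: N => [|N [b' Cb' IH]].
      by exists 0; [exact: subring0|rewrite mulr0 subr0].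
    exists (b + s * b'); first by apply: subringD => //; apply: subringM.
    by rewrite exprS IH /s; ring.
  rewrite mulrBr mulr1 mulKf // => h; apply: CVq.
  by rewrite -[q^-1](subrK b'); apply: subringD.
Qed.

Let rep (x : L) (n : nat) :=
  exists r : {poly L}, [/\ forall i, C r`_i, (size r <= n)%N & q * r.[x] = 1].

(* A relation [1 = q b(1/x)] gives [x^n = q r(x)] with [deg r < n], because [1 - q b_0] is
   a unit; this lowers the degree of the relation [1 = q a(x)]. *)
Let rep_step x n m : x != 0 -> (m <= n)%N -> rep x n.+1 -> rep x^-1 m.+1 -> rep x n.
Proof.
move=> x0 mn [a [Ca sa ea]] [b [Cb sb eb]].
pose s := 1 - q * b`_0.
have s0 : s != 0 := avoiding_one_sub_neq0 (Cb 0%N).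
have Cs : C s^-1 := avoiding_one_sub_unit (Cb 0%N).
have xn : x ^+ n = q * \sum_(i < n) s^-1 * b`_(n - i) * x ^+ i.
  have e : s * x ^+ n = q * \sum_(i < n) b`_(n - i) * x ^+ i.
    have E : x ^+ n = q * (b`_0 * x ^+ n) + q * \sum_(i < n) b`_(n - i) * x ^+ i.
      rewrite -[LHS]mul1r -eb (@horner_coef_wide _ n.+1) ?(leq_trans sb) //.
      rewrite -mulrA mulr_suml big_ord_recl /= expr0 mulr1 mulrDr.
      congr (_ + _ * _); rewrite (reindex_inj rev_ord_inj) /=; apply: eq_bigr => i _.
      have -> : bump 0 (n - i.+1) = (n - i)%N.
        by rewrite /bump /=; have := ltn_ord i; lia.
      rewrite -mulrA exprVn; congr (_ * _).
      have xE : x ^+ n = x ^+ (n - i) * x ^+ i by rewrite -exprD subnK // ltnW.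
      by rewrite xE mulKf // expf_neq0.
    by rewrite /s mulrBl mul1r {1}E; ring.
  apply: (mulfI s0); rewrite e mulrCA; congr (_ * _); rewrite mulr_sumr.
  by apply: eq_bigr => i _; rewrite !mulrA mulfV // mul1r.
exists (\poly_(i < n) (a`_i + a`_n * (q * (s^-1 * b`_(n - i))))); split.
- move=> i; rewrite coef_poly; case: ifP => _; last exact: subring0.
  by apply: subringD => //; apply: subringM => //; apply: subringM => //; apply: subringM.
- exact: size_poly.
rewrite horner_poly -ea (@horner_coef_wide _ n.+1 a) // big_ord_recr /=.
congr (_ * _); rewrite xn !mulr_sumr -big_split /=.
by apply: eq_bigr => i _; ring.
Qed.

(** Descent on n + m: [rep_step] shortens the longer of the two relations by means of the other one,
    until one has length zero and reads 0 = 1. *)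
Let no_rep N x n m : x != 0 -> (n + m <= N)%N -> rep x n -> rep x^-1 m -> False.
Proof.
have rep0 y : ~ rep y 0.
  case=> r [_ ]; rewrite leqn0 size_poly_eq0 => /eqP-> /eqP.
  by rewrite horner0 mulr0 eq_sym oner_eq0.
elim: N x n m => [|N IH] x [|n] [|m] // x0 nm rn rm; try by [apply: rep0 rn|apply: rep0 rm].
case: (leqP m n) => mn.
  have nm' : (n + m.+1 <= N)%N by lia.
  exact: (IH x n m.+1 x0 nm' (rep_step x0 mn rn rm) rm).
have nm' : (n.+1 + m <= N)%N by lia.
apply: (IH x n.+1 m x0 nm' rn).
by apply: (rep_step _ (ltnW mn) rm); rewrite ?invr_eq0 ?invrK.
Qed.

(** If neither x nor x^-1 is in C, maximality puts q^-1 into both C[x] and C[x^-1], against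
    [no_rep]. *)
Lemma avoiding_maximal_total x : x != 0 -> C x \/ C x^-1.
Proof.
have toRep y : ~ C y -> exists n, rep y n.
  move=> nCy.
  have [[r Cr' e]|nB] := boolp.EM (exists2 r : {poly L}, (forall i, C r`_i) & q^-1 = r.[y]).
    by exists (size r), r; rewrite -e mulfV.
  case: nCy; apply: (Cmax (B := fun z => exists2 r : {poly L}, (forall i, C r`_i) & z = r.[y])).
  - have inC z : C z -> exists2 r : {poly L}, (forall i, C r`_i) & z = r.[y].
      move=> Cz; exists z%:P; last by rewrite hornerC.
      by move=> i; rewrite coefC; case: ifP => _ //; exact: subring0.
    split=> //; first exact: subring_extend.
    by move=> z /CS0 /inC.
  - move=> z Cz; exists z%:P; last by rewrite hornerC.
    by move=> i; rewrite coefC; case: ifP => _ //; exact: subring0.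
  - exists 'X; last by rewrite hornerX.
    by move=> i; rewrite coefX; case: eqP => _; [exact: subring1|exact: subring0].
move=> x0; have [|nCx] := boolp.EM (C x); first by left.
have [|nCVx] := boolp.EM (C x^-1); first by right.
have [n rn] := toRep x nCx; have [m rm] := toRep _ nCVx.
by case: (@no_rep (n + m) x n m).
Qed.

End Maximal.

Lemma valuation_ring_exists : exists C : L -> Prop,
  [/\ is_subring C, (forall x, S0 x -> C x), ~ C q^-1 & forall x, x != 0 -> C x \/ C x^-1].
Proof.
have [C gC Cmax] := maximal_avoiding_subring.
exists C; case: (gC) => *; split=> // x; exact: (avoiding_maximal_total gC Cmax).
Qed.

End ValuationRings.

(** * From a valuation ring to a normalised discrete valuation *)

Section DiscreteValuation.
Variables (L : fieldType) (C : L -> Prop) (q : L).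
Hypotheses (Cr : is_subring C) (Ctot : forall x, x != 0 -> C x \/ C x^-1).
Hypotheses (Cq : C q) (CVq : ~ C q^-1).

Definition ring_unit x := C x /\ C x^-1.

Lemma ring_unit1 : ring_unit 1.
Proof. by split; rewrite ?invr1; apply: subring1. Qed.
Lemma ring_unitM x y : ring_unit x -> ring_unit y -> ring_unit (x * y).
Proof. by move=> [? ?] [? ?]; split; rewrite ?invfM; apply: subringM. Qed.
Lemma ring_unitV x : ring_unit x -> ring_unit x^-1.
Proof. by case=> ? ?; split; rewrite ?invrK. Qed.
Lemma ring_unitX x k : ring_unit x -> ring_unit (x ^+ k).
Proof. by case=> ? ?; split; rewrite -?exprVn; apply: subringX. Qed.
Lemma ring_unitXz x (z : int) : ring_unit x -> ring_unit (x ^ z).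
Proof.
move=> Ux; case: z => k; first exact: ring_unitX.
by rewrite NegzE -invr_expz; apply/ring_unitV/ring_unitX.
Qed.

Lemma valuation_uniformizer_neq0 : q != 0.
Proof. by apply/eqP => q0; apply: CVq; rewrite q0 invr0; apply: subring0. Qed.
Let q_neq0 := valuation_uniformizer_neq0.

Lemma valuation_uniformizerXz (m : int) : C (q ^ m) -> 0 <= m.
Proof.
case: m => // k; rewrite NegzE -invr_expz => h; case: CVq.
have -> : q^-1 = q ^+ k * (q ^ k.+1)^-1.
  by rewrite -exprnP exprSr invfM mulVKf ?expf_neq0.
by apply: subringM => //; apply: subringX.
Qed.

Lemma ring_unit_uniformizerXz (m : int) : ring_unit (q ^ m) -> m = 0.
Proof.
case=> /valuation_uniformizerXz m0; rewrite invr_expz => /valuation_uniformizerXz.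
by rewrite oppr_ge0 => m1; apply/eqP; rewrite eq_le m0 m1.
Qed.

(** The maximal ideal is closed under sums; zero is listed apart because its formal inverse 0 lies
    in C. If y/x is in C, then x^-1 = (x + y)^-1 (1 + y/x), so (x + y)^-1 in C would give x^-1 in
    C. *)
Lemma nonunit_sum I (s : seq I) (P : pred I) (f : I -> L) :
  (forall i, P i -> f i = 0 \/ ~ C (f i)^-1) ->
  \sum_(i <- s | P i) f i = 0 \/ ~ C (\sum_(i <- s | P i) f i)^-1.
Proof.
move=> fP; apply: (big_ind (fun z => z = 0 \/ ~ C z^-1)) => //; first by left.
have wlog_ad x y : x != 0 -> ~ C x^-1 -> C (y / x) -> x + y != 0 -> ~ C (x + y)^-1.
  move=> x0 nx yx xy h; apply: nx.
  have -> : x^-1 = (x + y)^-1 * (1 + y / x).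
    by apply: (mulfI xy); rewrite mulVKf // mulrDl mulfV.
  by apply: subringM => //; apply: subringD => //; exact: subring1.
move=> x y Mx My; have [xy0|xy] := eqVneq (x + y) 0; first by left.
right; case: Mx My xy => [->|nx] [->|ny]; rewrite ?addr0 ?add0r ?eqxx // => xy.
have [x0|x0] := eqVneq x 0; first by rewrite x0 add0r.
have [y0|y0] := eqVneq y 0; first by rewrite y0 addr0.
case: (@Ctot (y / x)); first by rewrite mulf_neq0 ?invr_eq0.
  by move=> yx; apply: wlog_ad.
by rewrite invfM invrK mulrC => xy'; rewrite addrC; apply: wlog_ad; rewrite // addrC.
Qed.

(** The index j is that of a member of least value. *)
Lemma valuation_max (I : eqType) (f : I -> L) (s : seq I) :
  s != [::] -> (forall i, i \in s -> f i != 0) ->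
  exists2 j, j \in s & forall i, i \in s -> C (f i / f j).
Proof.
elim: s => // a [|b s] IH _ f0.
  exists a; first by rewrite inE.
  by move=> i; rewrite inE => /eqP ->; rewrite mulfV ?f0 ?inE //; exact: subring1.
have [|j js jmax] := IH isT; first by move=> i /(mem_behead (s := a :: _)) /f0.
have fa : f a != 0 by apply: f0; rewrite inE eqxx.
have fj : f j != 0 by apply: f0; rewrite inE js orbT.
case: (@Ctot (f a / f j)); first by rewrite mulf_neq0 ?invr_eq0.
  move=> aj; exists j; first by rewrite inE js orbT.
  by move=> i; rewrite inE => /orP[/eqP->|/jmax].
rewrite invfM invrK mulrC => ja; exists a; first by rewrite inE eqxx.
move=> i; rewrite inE => /orP[/eqP->|/jmax ij]; first by rewrite mulfV //; exact: subring1.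
have -> : f i / f a = (f i / f j) * (f j / f a) by rewrite mulrA divfK.
exact: subringM.
Qed.

Section Normalize.
Variable D : nat.
Hypothesis D_gt0 : (0 < D)%N.
Hypothesis Dram : forall x, x != 0 -> exists m : int, ring_unit (x ^+ D / q ^ m).

(** By [Dram], x has value m/D when q has value 1. The exponent m is unique because no nonzero power
    of q is a unit, hence additive in x; C consists of 0 and the elements with m >= 0, which gives
    the ultrametric inequality. *)
Lemma discrete_valuation_of_ring : exists (w : L -> int) (e : nat),
  [/\ dval w, (0 < e)%N, w q = e%:Z & forall x, x != 0 -> ring_unit x -> w x = 0].
Proof.
have Dram' x : exists m : int, x != 0 -> ring_unit (x ^+ D / q ^ m).
  by have [->|x0] := eqVneq x 0; [exists 0|have [m] := Dram x0; exists m].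
have [w0 w0P] := boolp.choice Dram'.
have uniq x m : x != 0 -> ring_unit (x ^+ D / q ^ m) -> w0 x = m.
  move=> x0 h; have /ring_unitV h0 := w0P x x0; have := ring_unitM h h0.
  rewrite invfM invrK mulrACA mulfV ?expf_neq0 // mul1r mulrC invr_expz -expfzDr //.
  by move=> /ring_unit_uniformizerXz /eqP; rewrite subr_eq0 => /eqP.
have w0M x y : x != 0 -> y != 0 -> w0 (x * y) = w0 x + w0 y.
  move=> x0 y0; apply: uniq; first exact: mulf_neq0.
  rewrite exprMn expfzDr // invfM mulrACA.
  by apply: ring_unitM; apply: w0P.
have w0q : w0 q = D.
  apply: uniq => //; rewrite -exprnP mulfV ?expf_neq0 //; exact: ring_unit1.
have w0u x : x != 0 -> ring_unit x -> w0 x = 0.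
  move=> x0 Ux; by apply: uniq => //; rewrite expr0z divr1; apply: ring_unitX.
have w0C x : x != 0 -> C x <-> 0 <= w0 x.
  move=> x0; have [h1 h2] := w0P x x0; split=> [Cx|w0x].
    apply: valuation_uniformizerXz.
    have -> : q ^ w0 x = x ^+ D * (x ^+ D / q ^ w0 x)^-1.
      by rewrite invfM invrK mulrA mulfV ?expf_neq0 // mul1r.
    by apply: subringM => //; apply: subringX.
  have CxD : C (x ^+ D).
    rewrite -[x ^+ D](divfK (expfz_neq0 (w0 x) q_neq0)); apply: subringM => //.
    by case: (w0 x) w0x => // k _; rewrite -exprnP; apply: subringX.
  (* With x^D in C, the case of x^-1 in C is settled by x = x^D (x^-1)^(D-1). *)
  case: (Ctot x0) => // CVx; have -> : x = x ^+ D * x^-1 ^+ D.-1.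
    rewrite -{1}(prednK D_gt0) exprS exprVn mulfK ?expf_neq0 //.
  by apply: subringM => //; apply: subringX.
have w0V x : x != 0 -> w0 x^-1 = - w0 x.
  move=> x0; apply/eqP; rewrite -addr_eq0 -w0M ?invr_eq0 // mulVf //.
  by rewrite w0u ?oner_neq0 //; apply: ring_unit1.
have w0D x y : x != 0 -> y != 0 -> x + y != 0 -> Num.min (w0 x) (w0 y) <= w0 (x + y).
  have wl u v : u != 0 -> v != 0 -> u + v != 0 -> w0 u <= w0 v -> w0 u <= w0 (u + v).
    move=> u0 v0 uv le_uv.
    have vu0 : v / u != 0 by rewrite mulf_neq0 ?invr_eq0.
    have Cvu : C (v / u) by apply/w0C => //; rewrite w0M ?invr_eq0 ?w0V // subr_ge0.
    have C1 : C ((u + v) / u).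
      by rewrite mulrDl mulfV //; apply: subringD => //; exact: subring1.
    move/w0C: C1; rewrite mulf_neq0 ?invr_eq0 // => /(_ isT).
    by rewrite w0M ?invr_eq0 // w0V // subr_ge0.
  move=> x0 y0 xy; rewrite ge_min; case: (leP (w0 x) (w0 y)) => h; first by rewrite wl.
  by rewrite [x + y]addrC wl ?orbT //; [rewrite addrC|exact: ltW].
(* The values of [w0] form a subgroup of Z containing D. Its least positive element g generates it,
   by Euclidean division, and dividing by g makes the value 1 occur. *)
pose V (k : nat) := boolp.asbool (exists x, [/\ x != 0, w0 x = k%:Z & (0 < k)%N]).
have exV : exists k, V k by exists D; apply/boolp.asboolP; exists q.
case: (ex_minnP exV) => g /boolp.asboolP[pi [pi0 w0pi g_gt0]] gmin.
have g0 : (g : int) != 0 by rewrite -lt0n.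
have w0X x k : x != 0 -> w0 (x ^+ k) = w0 x *+ k.
  move=> x0; elim: k => [|k IH]; first by rewrite w0u ?oner_neq0 //; exact: ring_unit1.
  by rewrite exprS w0M ?expf_neq0 // IH mulrS.
have w0Xz x (z : int) : x != 0 -> w0 (x ^ z) = w0 x * z.
  move=> x0; case: z => k; first by rewrite -exprnP w0X // -mulr_natr natz.
  by rewrite NegzE -invr_expz w0V ?expfz_neq0 // -exprnP w0X // -mulr_natr natz mulrN.
have gdvd x : x != 0 -> (g %| w0 x)%Z.
  move=> x0; rewrite dvdz_eq; apply/eqP.
  have := divz_eq (w0 x) g; set z := (w0 x %/ g)%Z; set r := (w0 x %% g)%Z => e.
  suff r0 : r = 0 by rewrite e r0 addr0.
  have : 0 <= r by apply: modz_ge0.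
  have : r < g by apply: ltz_pmod; rewrite ltz_nat.
  have rE : w0 (x * pi ^ (- z)) = r.
    by rewrite w0M ?expfz_neq0 // w0Xz // w0pi e; ring.
  case: (r) rE => // -[|k] // rE kg _.
  have /gmin : V k.+1.
    by apply/boolp.asboolP; exists (x * pi ^ (- z)); rewrite mulf_neq0 ?expfz_neq0.
  by rewrite leqNgt -ltz_nat kg.
exists (fun x => (w0 x %/ g)%Z), (D %/ g)%N; split.
- split.
  + by move=> x y x0 y0; rewrite w0M // divzDl // gdvd.
  + move=> x y x0 y0 xy; have := w0D x y x0 y0 xy.
    rewrite !ge_min => /orP[h|h]; apply/orP; [left|right]; exact: lez_pdiv2r.
  + by exists pi; rewrite w0pi divzz g0.
- have := gdvd q q_neq0; rewrite w0q => gD; rewrite divn_gt0 //.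
  by apply: dvdn_leq.
- by rewrite w0q divz_nat.
- by move=> x x0 Ux; rewrite w0u // div0z.
Qed.

End Normalize.
End DiscreteValuation.

Lemma fractionP (R : idomainType) (x : {fraction R}) :
  exists f g : R, g != 0 /\ x = tofrac f / tofrac g.
Proof.
elim/quotW: x => x; exists (frac x).1, (frac x).2; split; first exact: denom_ratioP.
apply: (canRL (mulfK _)); first by rewrite tofrac_eq0 denom_ratioP.
apply/eqP; rewrite -[X in X == _]/(FracField.mul _ _) !piE /=.
rewrite /FracField.equivf /FracField.mulf !numden_Ratio ?mulf_neq0 ?oner_eq0 ?denom_ratioP //.
by rewrite !mulr1 mulrC.
Qed.

Lemma irreducible_multiplicity (F : fieldType) (Q f : {poly F}) :
  irreducible_poly Q -> f != 0 -> exists m g, f = Q ^+ m * g /\ ~~ (Q %| g).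
Proof.
move=> [szQ _]; have [n] := ubnP (size f); elim: n f => // n IH f sz f0.
have [/dvdpP[g fE]|] := boolP (Q %| f); last by exists 0%N, f; rewrite mul1r.
have g0 : g != 0 by apply: contraNneq f0 => g0; rewrite fE g0 mul0r.
have Q0 : Q != 0 by rewrite -size_poly_gt0 ltnW.
have [|m [h [gE hQ]]] := IH g _ g0.
  move: sz; rewrite fE size_mul //; move: szQ; case: (size Q) => [|[|k]] // _.
  by rewrite !addnS /= ltnS; apply: leq_trans; rewrite ltnS leq_addr.
by exists m.+1, h; rewrite fE gE exprS mulrC mulrA.
Qed.

Lemma irreducible_not_dvdM (F : fieldType) (Q f g : {poly F}) : irreducible_poly Q ->
  ~~ (Q %| f) -> ~~ (Q %| g) -> ~~ (Q %| f * g).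
Proof. by move=> irr; rewrite -!irreducible_poly_coprime // coprimepMr => -> ->. Qed.

Lemma divf_cancel_powers (K : fieldType) (x y a b : K) :
  x != 0 -> y != 0 -> b != 0 -> (x * a) / (y * b) / (x / y) = a / b.
Proof. by move=> x0 y0 b0; field; rewrite x0 y0 b0. Qed.

Lemma divf_ratio (K : fieldType) (a b x y z : K) : a != 0 -> b != 0 -> y != 0 -> z != 0 ->
  x / y / z = (a * x) / (b * y) * (b / a / z).
Proof. by move=> a0 b0 y0 z0; field; rewrite a0 b0 y0 z0. Qed.

Lemma in_alg_eq0 (K : fieldType) (E : fieldExtType K) (c : K) : (c%:A == 0 :> E) = (c == 0).
Proof. by rewrite scaler_eq0 oner_eq0 orbF. Qed.

Lemma divf_neq0 (K : fieldType) (a b : K) : a != 0 -> b != 0 -> a / b != 0.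
Proof. by move=> a0 b0; rewrite mulf_neq0 ?invr_eq0. Qed.

Lemma absz_sub_leq (i j s d : nat) :
  (i < s)%N -> (j < s)%N -> (s <= d.+1)%N -> (`|(i%:Z - j%:Z)%R|%N <= d)%N.
Proof. by lia. Qed.

(** * Valuations of L above a prime Q *)

Section ExtendValuation.
Variables (F : finFieldType) (L : fieldExtType (ratfun F)) (Q : {poly F}).
Hypothesis irrQ : irreducible_poly Q.

Local Notation ev := (in_alg L).
Let q : L := (tofrac Q)%:A.

Definition local_ring (x : L) : Prop :=
  exists f g : {poly F}, ~~ (Q %| g) /\ x = (tofrac f / tofrac g)%:A.

Let Q_neq0 : Q != 0. Proof. exact: irredp_neq0. Qed.

Let ndvd_neq0 (g : {poly F}) : ~~ (Q %| g) -> tofrac g != 0.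
Proof. by rewrite tofrac_eq0; apply: contraNneq => ->; rewrite dvdp0. Qed.

Let ndvd1 : ~~ (Q %| 1).
Proof. by rewrite dvdp1; case: irrQ => h _; rewrite gtn_eqF. Qed.

Lemma local_ring_subring : is_subring local_ring.
Proof.
split.
- by exists 1, 1; rewrite tofrac1 divr1 scale1r.
- move=> _ _ [f [g [gQ ->]]] [f' [g' [gQ' ->]]].
  exists (f * g' - f' * g), (g * g'); split; first exact: irreducible_not_dvdM.
  rewrite -scalerBl; congr (_ *: _); rewrite tofracB !tofracM.
  by rewrite -!mulNr addf_div ?ndvd_neq0.
- move=> _ _ [f [g [gQ ->]]] [f' [g' [gQ' ->]]].
  exists (f * f'), (g * g'); split; first exact: irreducible_not_dvdM.
  rewrite -[LHS](rmorphM ev); congr (_ *: _).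
  by rewrite mulf_div -!tofracM.
Qed.

Lemma local_ring_uniformizer : local_ring q.
Proof. by exists Q, 1; rewrite tofrac1 divr1. Qed.

Lemma local_ring_uniformizerV : ~ local_ring q^-1.
Proof.
case=> f [g [gQ]]; rewrite -(fmorphV ev) => /(fmorph_inj ev) e; case/negP: (gQ).
apply/dvdpP; exists f; apply/eqP; rewrite -tofrac_eq tofracM.
have -> : tofrac f = tofrac g / tofrac Q by rewrite e mulrC divfK ?ndvd_neq0.
by rewrite divfK // tofrac_eq0.
Qed.

(** Polynomials prime to Q are units of [local_ring], so on k the valuation is a multiple of the one
    at Q. Discreteness comes from the finite degree d: some x^z with 0 < |z| <= d is a unit times an
    element of k, hence a unit times a power of q. *)
Lemma exists_extended_valuation :
  exists (w : L -> int) (e : nat), [/\ dval w, lies_over Q w e & (0 < e)%N].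
Proof.
have [C [Cr CA CVq Ctot]] := valuation_ring_exists local_ring_subring
  local_ring_uniformizer local_ring_uniformizerV.
have Cq : C q by apply: CA; apply: local_ring_uniformizer.
have q0 : q != 0 by rewrite in_alg_eq0 tofrac_eq0.
have Upoly f : ~~ (Q %| f) -> ring_unit C (tofrac f)%:A.
  move=> fQ; split; apply: CA; first by exists f, 1; rewrite tofrac1 divr1.
  by exists 1, f; rewrite -(fmorphV ev) tofrac1 mul1r.
have Uk (c : ratfun F) : c != 0 -> exists m : int, ring_unit C (c%:A / q ^ m).
  have [f [g [g0 ->]]] := fractionP c.
  rewrite mulf_eq0 invr_eq0 !tofrac_eq0 negb_or => /andP[f0 _].
  have [a [f' [-> f'Q]]] := irreducible_multiplicity irrQ f0.
  have [b [g' [-> g'Q]]] := irreducible_multiplicity irrQ g0.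
  exists (a%:Z - b%:Z).
  have [psi [psiE psiM psiX]] : exists psi : {poly F} -> L,
     [/\ forall f1, psi f1 = (tofrac f1)%:A,
         forall f1 f2, psi (f1 * f2) = psi f1 * psi f2
       & forall f1 k, psi (f1 ^+ k) = psi f1 ^+ k].
    exists (fun f1 => (tofrac f1)%:A); split=> // [f1 f2|f1 k].
      by rewrite tofracM -[LHS]/(ev _) rmorphM.
    by rewrite tofracXn -[LHS]/(ev _) rmorphXn.
  have -> : (tofrac (Q ^+ a * f') / tofrac (Q ^+ b * g'))%:A
          = psi (Q ^+ a * f') / psi (Q ^+ b * g').
    by rewrite !psiE -[LHS]/(ev _) rmorphM fmorphV.
  have g'0 : psi g' != 0 by rewrite psiE in_alg_eq0 ndvd_neq0.
  rewrite expfzDr // -invr_expz -!exprnP !psiM !psiX /q -psiE.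
  have psiQ0 : psi Q != 0 by rewrite psiE.
  rewrite divf_cancel_powers ?expf_neq0 // !psiE.
  exact: (ring_unitM Cr (Upoly _ f'Q) (ring_unitV (Upoly _ g'Q))).
pose d := \dim {:L}.
(* In a vanishing sum over [k] of powers of [x], two terms have the same value. *)
have ram x : x != 0 -> exists (z : int) (m : int),
    [/\ z != 0, (`|z| <= d)%N & ring_unit C (x ^ z / q ^ m)].
  move=> x0; pose mu := minPoly 1%AS x.
  have szmu : (size mu <= d.+1)%N.
    rewrite size_minPoly ltnS; have := dim_Fadjoin 1%AS x; rewrite dimv1 muln1 => <-.
    exact: dimvS (subvf _).
  pose t i := mu`_i * x ^+ i.
  have t_eq0 i : (t i == 0) = (mu`_i == 0) by rewrite mulf_eq0 expf_eq0 (negPf x0) andbF orbF.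
  have mu_k i : exists c : ratfun F, mu`_i = c%:A.
    by apply/vlineP; have /polyOverP := minPolyOver 1%AS x; apply.
  pose s := [seq i <- iota 0 (size mu) | mu`_i != 0].
  have s_neq0 : s != [::].
    have : (size mu).-1 \in s.
      rewrite mem_filter -lead_coefE lead_coef_eq0 monic_neq0 ?monic_minPoly //=.
      by rewrite mem_iota add0n /mu size_minPoly /=.
    by case: (s).
  have [|j js jmax] := @valuation_max _ C Cr Ctot nat t s s_neq0.
    by move=> i; rewrite mem_filter t_eq0 => /andP[].
  have tj : t j != 0 by move: js; rewrite mem_filter t_eq0 => /andP[].
  have [[i [i_s ij Ui]]|nU] := boolp.EM (exists i, [/\ i \in s, i != j & C (t i / t j)^-1]).
    have [ci ciE] := mu_k i; have [cj cjE] := mu_k j.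
    move: (i_s) (js); rewrite !mem_filter !mem_iota !add0n ciE cjE.
    move=> /and3P[ci0 _ isz] /and3P[cj0 _ jsz].
    have c0 : cj / ci != 0.
      by apply: divf_neq0; [rewrite -(in_alg_eq0 L) | rewrite -(in_alg_eq0 L)].
    have [m Um] := Uk _ c0.
    exists (i%:Z - j%:Z), m; split; [by rewrite subr_eq0 eqz_nat|exact: absz_sub_leq szmu|].
    have -> : x ^ (i%:Z - j%:Z) / q ^ m = (t i / t j) * ((cj / ci)%:A / q ^ m).
      rewrite expfzDr // -invr_expz -!exprnP /t ciE cjE -[(cj / ci)%:A]/(ev _) rmorphM fmorphV.
      by apply: divf_ratio => //; rewrite ?expf_neq0 ?expfz_neq0.
    by apply: ring_unitM => //; split=> //; apply: jmax.
  have /rootP := root_minPoly 1%AS x; rewrite horner_coef => mu0.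
  have jlt : (j < size mu)%N by move: js; rewrite mem_filter mem_iota => /and3P[].
  have : \sum_(i < size mu) t i / t j = 0 by rewrite -mulr_suml mu0 mul0r.
  rewrite (bigD1 (Ordinal jlt)) //= mulfV // => /eqP; rewrite addrC addr_eq0 => /eqP sE.
  (* If no other term shares the least value, all the other quotients t_i / t_j are zero or
     nonunits, yet they sum to -1. *)
  have [] := @nonunit_sum _ C Cr Ctot _ (index_enum 'I_(size mu))
    (fun i => i != Ordinal jlt) (fun i => t i / t j).
  - move=> i ij; have [ti|ti] := eqVneq (t i) 0; first by left; rewrite ti mul0r.
    right=> h; apply: nU; exists (val i); split=> //.
    by rewrite mem_filter -t_eq0 ti mem_iota /=.
  - by rewrite sE => /eqP; rewrite oppr_eq0 oner_eq0.
  - by rewrite sE invrN invr1; case; apply: subringN => //; apply: subring1.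
(* The exponent z varies with x; d! is a multiple of all of them. *)
have Dram x : x != 0 -> exists m : int, ring_unit C (x ^+ d`! / q ^ m).
  move=> x0; have [z [m [z0 zd Uz]]] := ram x x0.
  have /dvdzP[z' dE] : (z %| d`!%:Z)%Z.
    by rewrite dvdzE /=; apply: dvdn_fact; rewrite zd absz_gt0 z0.
  exists (m * z'); have := ring_unitXz Cr z' Uz.
  by rewrite expfzMl -expfV !exprz_exp [z * z']mulrC -dE -exprnP.
have [w [e [wd e0 we wu]]] := discrete_valuation_of_ring Cr Ctot Cq CVq (fact_gt0 d) Dram.
exists w, e; split=> // f m f0 /dvdpP[g fE] nd.
have gQ : ~~ (Q %| g).
  by apply: contraNN nd => /dvdpP[h gE]; rewrite fE gE -mulrA -exprS dvdp_mull.
have wX k : w (q ^+ k) = (e * k)%:Z.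
  case: wd => wM _ _; elim: k => [|k IH].
    by rewrite muln0 wu ?oner_neq0 //; apply: ring_unit1.
  by rewrite exprS wM ?expf_neq0 // IH we mulnS PoszD.
have -> : (tofrac f)%:A = (tofrac g)%:A * q ^+ m.
  by rewrite fE tofracM tofracXn -[LHS]/(ev _) rmorphM rmorphXn.
have g0 : (tofrac g)%:A != 0 :> L by rewrite in_alg_eq0 ndvd_neq0.
by case: (wd) => wM _ _; rewrite wM ?expf_neq0 // wX wu ?add0r //; apply: Upoly.
Qed.

End ExtendValuation.

(** * Artin-Schreier reduction of rational functions *)

Definition asmap (p : nat) (R : nzRingType) (a : R) : R := a ^+ p - a.

Section ArtinSchreierMap.
Variables (p : nat) (R : comNzRingType).
Hypothesis pR : p \in [pchar R].

Lemma exprDp_pchar (a b : R) : (a + b) ^+ p = a ^+ p + b ^+ p.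
Proof. by rewrite -!(pFrobenius_autE pR) pFrobenius_autD_comm //; exact: mulrC. Qed.

Lemma exprNp_pchar (a : R) : (- a) ^+ p = - a ^+ p.
Proof. by rewrite -!(pFrobenius_autE pR) pFrobenius_autN. Qed.

Lemma exprBp_pchar (a b : R) : (a - b) ^+ p = a ^+ p - b ^+ p.
Proof. by rewrite exprDp_pchar exprNp_pchar. Qed.

Lemma asmapD (a b : R) : asmap p (a + b) = asmap p a + asmap p b.
Proof. by rewrite /asmap exprDp_pchar; ring. Qed.

End ArtinSchreierMap.

Lemma finField_pth_root (F : finFieldType) (p : nat) : p \in [pchar F] ->
  forall b : F, exists c, b = c ^+ p.
Proof.
move=> pF b; have inj : injective (fun c : F => c ^+ p).
  move=> c d /= /eqP; rewrite -subr_eq0 -(exprBp_pchar pF) expf_eq0 subr_eq0.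
  by case/andP=> _ /eqP.
by have /codomP[c ->] := injF_onto inj b; exists c.
Qed.

Lemma monic_irreducible_factor (F : fieldType) (D : {poly F}) : (1 < size D)%N ->
  exists Q, [/\ Q \is monic, irreducible_poly Q & Q %| D].
Proof.
have [n] := ubnP (size D); elim: n D => // n IH D sz szD.
have D0 : D != 0 by rewrite -size_poly_gt0 ltnW.
have lD : lead_coef D != 0 by rewrite lead_coef_eq0.
have [[_ irrD]|nirr] := boolp.EM (irreducible_poly D).
  have DD : (lead_coef D)^-1 *: D %= D by apply: eqp_scale; rewrite invr_eq0.
  exists ((lead_coef D)^-1 *: D); split; last by rewrite (eqp_dvdl _ DD).
    by rewrite monicE lead_coefZ mulVf.
  split=> [|q szq]; first by rewrite (eqp_size DD).
  by rewrite (eqp_dvdr _ DD) => qD; rewrite (eqp_rtrans DD) irrD.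
have [q [szq qD nqD]] : exists q : {poly F}, [/\ size q != 1%N, q %| D & ~~ (q %= D)].
  have [//|h] := boolp.EM (exists q : {poly F}, [/\ size q != 1%N, q %| D & ~~ (q %= D)]).
  case: nirr; split=> // q szq qD; have [//|nq] := boolP (q %= D).
  by case: h; exists q.
have q0 : q != 0 by apply: contraTneq qD => ->; rewrite dvd0p.
have ltq : (size q < size D)%N.
  rewrite ltn_neqAle dvdp_leq // andbT; apply: contraNneq nqD => e.
  by rewrite -(dvdp_size_eqp qD) e.
have [||Q [mQ iQ Qq]] := IH q; first exact: leq_trans ltq _.
  by rewrite ltn_neqAle eq_sym szq size_poly_gt0.
by exists Q; split=> //; apply: dvdp_trans Qq qD.
Qed.

(** * Lowering poles and degrees modulo a^p - a *)

Section Reduction.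
Variables (F : finFieldType) (p : nat).
Hypothesis pF : p \in [pchar F].

Let p_pr : prime p. Proof. exact: pcharf_prime pF. Qed.
Let pP : p \in [pchar {poly F}].
Proof. by rewrite (rmorph_pchar (@polyC F)). Qed.

(** Frobenius is injective on the residue field at Q, which is finite, so it is onto. The residue
    field is represented by coefficient rows of length deg Q. *)
Lemma irreducible_frobenius_onto (Q A : {poly F}) : irreducible_poly Q ->
  exists g, Q %| A - g ^+ p.
Proof.
move=> irrQ; have Q0 := irredp_neq0 irrQ; pose d := (size Q).-1.
have szm (f : {poly F}) : (size (f %% Q)%R <= d)%N.
  by rewrite -ltnS /d prednK ?size_poly_gt0 // ltn_modp.
pose h (u : 'rV[F]_d) : 'rV[F]_d := poly_rV ((rVpoly u ^+ p) %% Q).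
have inj : injective h.
  move=> u v /(congr1 rVpoly); rewrite !poly_rV_K // => /eqP.
  rewrite -subr_eq0 -modpN -modpD -(exprBp_pchar pP) -/(dvdp _ _) => Qp.
  have Quv : Q %| rVpoly u - rVpoly v.
    apply: contraLR Qp => nQ.
    elim: (p) => [|k IH]; first by rewrite dvdp1; case: irrQ => hh _; rewrite gtn_eqF.
    by rewrite exprS; apply: irreducible_not_dvdM.
  rewrite -[u]rVpolyK -[v]rVpolyK; congr poly_rV; apply/eqP; rewrite -subr_eq0.
  apply: contraTT Quv => uv; apply/negP => /(dvdp_leq uv); apply/negP; rewrite -ltnNge.
  rewrite -(prednK (n := size Q)) ?size_poly_gt0 // ltnS.
  by rewrite (leq_trans (size_polyD _ _)) // geq_max size_polyN !size_poly.
have /codomP[u /(congr1 rVpoly)] := injF_onto inj (poly_rV (A %% Q)).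
rewrite !poly_rV_K // => e; exists (rVpoly u).
by rewrite /dvdp modpD modpN e subrr.
Qed.

(** When deg f = pm, the leading coefficient is some c^p, and a = -c T^m replaces the leading term
    by c T^m, of lower degree. *)
Lemma polynomial_reduction (f : {poly F}) : exists a f' : {poly F},
  f + asmap p a = f' /\ ((1 < size f')%N -> ~~ (p %| (size f').-1)%N).
Proof.
have [n] := ubnP (size f); elim: n f => // n IH f sz.
have [sz1|sz1] := leqP (size f) 1.
  by exists 0, f; rewrite /asmap expr0n gtn_eqF ?prime_gt0 // subrr addr0 ltnNge sz1.
have [/dvdnP[m dm]|nd] := boolP (p %| (size f).-1)%N; last first.
  by exists 0, f; rewrite /asmap expr0n gtn_eqF ?prime_gt0 // subrr addr0.
have [c cE] := finField_pth_root pF (lead_coef f).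
have f0 : f != 0 by rewrite -size_poly_gt0 ltnW.
pose a0 := - (c *: 'X^m).
have e0 : f + asmap p a0 = (f - lead_coef f *: 'X^((size f).-1)) + c *: 'X^m.
  rewrite /asmap /a0 (exprNp_pchar pP) exprZn -cE -exprM -dm; ring.
have [|a1 [f' [e1 P1]]] := IH (f + asmap p a0).
  rewrite -ltnS; apply: leq_trans sz; rewrite ltnS e0.
  apply: leq_ltn_trans (size_polyD _ _) _; rewrite gtn_max; apply/andP; split.
    have -> : size f = (size f).-1.+1 by rewrite prednK // size_poly_gt0.
    rewrite ltnS; apply/leq_sizeP => j; rewrite leq_eqVlt => /orP[/eqP<-|jj].
      by rewrite coefB coefZ coefXn eqxx mulr1 lead_coefE subrr.
    rewrite coefB coefZ coefXn (gtn_eqF jj) mulr0 subr0 nth_default //.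
    by rewrite -(prednK (n := size f)) ?size_poly_gt0.
  apply: leq_ltn_trans (size_scale_leq _ _) _; rewrite size_polyXn.
  have m0 : (0 < m)%N by move: dm; case: (m) => //; rewrite mul0n; case: (size f) sz1 => [|[]].
  have := prime_gt1 p_pr; move: dm sz1; case: (size f) => // k /= -> _ p1; nia.
by exists (a0 + a1), f'; split=> //; rewrite asmapD // addrA.
Qed.

Definition reduced_pole (Q N : {poly F}) (e : nat) : bool :=
  [&& ~~ (p %| e)%N, coprimep N Q & (size N < size (Q ^+ e)%R)%N].

Section Fractions.
Variables (K : fieldType) (phi : {rmorphism {poly F} -> K}).
Hypothesis phi_neq0 : forall f, f != 0 -> phi f != 0.

Let pK : p \in [pchar K].
Proof. exact: (rmorph_pchar phi). Qed.

(** When e = pm, choose g with A = g^p modulo Q: adding a^p - a for a = -g/Q^m replaces the pole of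
    order e by poles of order below e. When p does not divide e and Q does not divide A, division of
    A by Q^e splits off the polynomial part. *)
Lemma local_reduction (Q A : {poly F}) e : irreducible_poly Q ->
  exists a f, phi A / phi Q ^+ e + asmap p a = phi f \/
    exists N e', [/\ (0 < e')%N, reduced_pole Q N e' &
      phi A / phi Q ^+ e + asmap p a = phi N / phi Q ^+ e' + phi f].
Proof.
move=> irrQ; have Q0 := irredp_neq0 irrQ; have phiQ := phi_neq0 Q0.
have as0 : asmap p (0 : K) = 0 by rewrite /asmap expr0n gtn_eqF ?prime_gt0 // subrr.
elim/ltn_ind: e A => -[_ A|e IH A].
  by exists 0, A; left; rewrite as0 addr0 expr0 divr1.
have [/dvdpP[B ->]|nQA] := boolP (Q %| A).
  have -> : phi (B * Q) / phi Q ^+ e.+1 = phi B / phi Q ^+ e.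
    by rewrite rmorphM exprS; field; rewrite phiQ expf_neq0.
  exact: IH.
have [/dvdnP[m em]|npe] := boolP (p %| e.+1)%N.
  have [g /dvdpP[B BE]] := irreducible_frobenius_onto A irrQ.
  have m0 : (0 < m)%N by move: em; case: (m).
  have me : (m <= e)%N by have := prime_gt1 p_pr; nia.
  pose a0 := - (phi g / phi Q ^+ m).
  have e0 : phi A / phi Q ^+ e.+1 + asmap p a0 =
      phi (B + g * Q ^+ (e - m)) / phi Q ^+ e.
    rewrite /asmap /a0 (exprNp_pchar pK) expr_div_n -exprM -em opprK addrA -mulrBl.
    have -> : phi A - phi g ^+ p = phi (B * Q) by rewrite -BE rmorphB rmorphXn.
    rewrite rmorphM rmorphD rmorphM rmorphXn exprS.
    have -> : phi Q ^+ e = phi Q ^+ (e - m) * phi Q ^+ m by rewrite -exprD subnK.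
    by field; rewrite phiQ !expf_neq0.
  have [a [f [fE|[N [e' [e'0 rN eq]]]]]] := IH e (ltnSn e) (B + g * Q ^+ (e - m)).
    by exists (a0 + a), f; left; rewrite asmapD // addrA e0.
  by exists (a0 + a), f; right; exists N, e'; split=> //; rewrite asmapD // addrA e0.
exists 0, (A %/ Q ^+ e.+1); right; exists (A %% Q ^+ e.+1), e.+1; split=> //.
  apply/and3P; split=> //; last by rewrite ltn_modp expf_neq0.
  rewrite coprimep_sym irreducible_poly_coprime //; apply: contraNN nQA => h.
  by rewrite (divp_eq A (Q ^+ e.+1)) dvdp_add // dvdp_mull // exprS dvdp_mulr.
rewrite as0 addr0 {1}(divp_eq A (Q ^+ e.+1)) rmorphD rmorphM rmorphXn.
by rewrite addrC mulrDl mulfK // expf_neq0.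
Qed.

(** Partial fractions, one prime power at a time: with D = Q^m D' and u Q^m + v D' = 1, N/D = N u/D'
    + N v/Q^m. *)
Lemma global_reduction (N D : {poly F}) : D != 0 ->
  exists (a : K) (f : {poly F}) (S : seq {poly F}) (Nf : {poly F} -> {poly F})
         (ef : {poly F} -> nat),
    [/\ uniq S, (forall Q, Q \in S -> [/\ Q \is monic, irreducible_poly Q, Q %| D,
                                       (0 < ef Q)%N & reduced_pole Q (Nf Q) (ef Q)])
      & phi N / phi D + asmap p a = \sum_(Q <- S) phi (Nf Q) / phi Q ^+ ef Q + phi f].
Proof.
have as0 : asmap p (0 : K) = 0 by rewrite /asmap expr0n gtn_eqF ?prime_gt0 // subrr.
have [n] := ubnP (size D); elim: n D N => // n IH D N sz D0.
have [sz1|sz1] := leqP (size D) 1.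
  have /size_poly1P[d d0 DE] : size D == 1%N by rewrite eqn_leq sz1 size_poly_gt0.
  exists 0, (d^-1 *: N), [::], (fun=> 0), (fun=> 0%N); split=> //.
  rewrite big_nil add0r as0 addr0 DE -mul_polyC rmorphM mulrC; congr (_ * _).
  apply: (mulfI (phi_neq0 _ : phi d%:P != 0)); first by rewrite polyC_eq0.
  rewrite mulfV ?phi_neq0 ?polyC_eq0 // -rmorphM -polyCM mulfV //.
  by rewrite polyC1 rmorph1.
have [Q [mQ irrQ QD]] := monic_irreducible_factor sz1.
have [m [D' [DE QD']]] := irreducible_multiplicity irrQ D0.
have D'0 : D' != 0 by apply: contraNneq QD' => ->; rewrite dvdp0.
have Q0 := irredp_neq0 irrQ.
have m0 : (0 < m)%N.
  by rewrite lt0n; apply: contraNneq QD' => m0; rewrite -(mul1r D') -(expr0 Q) -m0 -DE.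
have szD' : (size D' < n)%N.
  rewrite -ltnS; apply: leq_trans sz; rewrite ltnS DE size_mul ?expf_neq0 //.
  have : (1 < size (Q ^+ m))%N.
    apply: leq_trans (dvdp_leq (expf_neq0 m Q0) (dvdp_exp2l Q m0)).
    by rewrite expr1; case: irrQ.
  by case: (size (Q ^+ m)) => [|[|k]] // _; rewrite !addSn /= ltnS leq_addl.
have /Bezout_eq1_coprimepP[[u v] /= uv] : coprimep (Q ^+ m) D'.
  by rewrite coprimep_expl // irreducible_poly_coprime.
have [a1 [f1 [S [Nf [ef [uS SP e1]]]]]] := IH D' (N * u) szD' D'0.
have phiQ := phi_neq0 Q0; have phiD' := phi_neq0 D'0.
have split_e : phi N / phi D = phi (N * u) / phi D' + phi (N * v) / phi Q ^+ m.
  have : phi u * phi Q ^+ m + phi v * phi D' = 1.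
    by rewrite -rmorphXn -!rmorphM -rmorphD uv rmorph1.
  rewrite DE !rmorphM rmorphXn => h.
  rewrite -[LHS]mulr1 -h; field; rewrite phiD' expf_neq0 //.
have QS : Q \notin S by apply: contraNN QD' => /SP[].
have [a2 [f2 [e2|[N2 [e' [e'0 rN e2]]]]]] := local_reduction (N * v) m irrQ.
  exists (a1 + a2), (f1 + f2), S, Nf, ef; split=> //.
    by move=> R /SP[? ? h ? ?]; split=> //; rewrite DE dvdp_mull.
  by rewrite split_e asmapD // addrACA e1 e2 rmorphD addrA.
exists (a1 + a2), (f1 + f2), (Q :: S), (fun R => if R == Q then N2 else Nf R),
  (fun R => if R == Q then e' else ef R); split; first by rewrite /= QS.
  move=> R; rewrite inE; have [-> _|nRQ /= /SP[? ? h ? ?]] := eqVneq R Q; first by split.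
  by split=> //; rewrite DE dvdp_mull.
rewrite split_e asmapD // addrACA e1 e2 rmorphD big_cons eqxx.
rewrite [X in _ = _ + X + _](_ : _ = \sum_(R <- S) phi (Nf R) / phi R ^+ ef R); last first.
  by apply: eq_big_seq => R RS; rewrite (negPf (contraNneq _ QS)) // => <-.
by ring.
Qed.

Lemma sum_without_pole (Q f : {poly F}) (S : seq {poly F}) Nf ef : irreducible_poly Q ->
  (forall R, R \in S -> R \is monic /\ irreducible_poly R) -> Q \is monic -> Q \notin S ->
  exists Z Y, ~~ (Q %| Y) /\
    \sum_(R <- S) phi (Nf R) / phi R ^+ ef R + phi f = phi Z / phi Y.
Proof.
move=> irrQ + mQ; have ndvd1 : ~~ (Q %| 1).
  by rewrite dvdp1; case: irrQ => h _; rewrite gtn_eqF.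
elim: S => [|R S IH] SP; first by exists f, 1; rewrite big_nil add0r rmorph1 divr1.
rewrite inE negb_or => /andP[QR QS].
have [mR irrR] := SP R (mem_head _ _).
have [|Z [Y [QY e]]] := IH _ QS; first by move=> R' R'S; apply: SP; rewrite inE R'S orbT.
have nQR : ~~ (Q %| R ^+ ef R).
  elim: (ef R) => [//|k IHk]; rewrite exprS; apply: irreducible_not_dvdM => //.
  apply: contraNN QR => QdR; case: irrR => _ /(_ Q) h.
  by rewrite -eqp_monic // h //; case: irrQ => ? _; rewrite gtn_eqF.
have nz (g : {poly F}) : ~~ (Q %| g) -> phi g != 0.
  by move=> ng; apply: phi_neq0; apply: contraNneq ng => ->; rewrite dvdp0.
exists (Nf R * Y + Z * R ^+ ef R), (R ^+ ef R * Y); split.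
  exact: irreducible_not_dvdM.
rewrite big_cons -addrA e -rmorphXn addf_div ?nz //.
by rewrite -!rmorphM -rmorphD.
Qed.

(** The hypothesis on primes outside P quantifies over a because the reduction chooses it. A reduced
    pole has order prime to p, so none survives at such a prime. *)
Lemma artin_schreier_reduction (r : nat) (P : 'I_r -> {poly F}) (N D : {poly F}) :
  injective P -> D != 0 ->
  (forall Q, Q \is monic -> irreducible_poly Q -> (forall i, Q <> P i) ->
    forall a X Y e, ~~ (Q %| X) -> ~~ (Q %| Y) -> (0 < e)%N ->
      phi N / phi D + asmap p a = phi X / (phi Q ^+ e * phi Y) -> (p %| e)%N) ->
  exists (a : K) (q : 'I_r -> {poly F}) (e : 'I_r -> nat) (f : {poly F}),
    [/\ phi N / phi D + asmap p a = \sum_i phi (q i) / phi (P i) ^+ e i + phi f,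
        (forall i, (0 < e i)%N -> reduced_pole (P i) (q i) (e i))
      & ((1 < size f)%N -> ~~ (p %| (size f).-1)%N)].
Proof.
move=> injP D0 H; have [a [f0 [S [Nf [ef [uS SP eS]]]]]] := global_reduction N D0.
have [b [f [fE fP]]] := polynomial_reduction f0.
have nz (Q g : {poly F}) : ~~ (Q %| g) -> phi g != 0.
  by move=> ng; apply: phi_neq0; apply: contraNneq ng => ->; rewrite dvdp0.
have SP' Q : Q \in S -> exists i, Q = P i.
  move=> QS; have [//|nP] := boolp.EM (exists i, Q = P i).
  have [mQ irrQ QD eQ /and3P[npe cN _]] := SP Q QS.
  have Q0 := irredp_neq0 irrQ.
  case/negP: npe; have [Z [Y [QY ZE]]] := @sum_without_pole Q f0 (rem Q S) Nf ef irrQ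
    (fun R RS => let: And5 h1 h2 _ _ _ := SP R (mem_rem RS) in conj h1 h2) mQ
    (negbT (mem_rem_uniqF Q uS)).
  (* Numerator of N_Q/Q^e + Z/Y over the denominator Q^e Y; it is prime to Q since N_Q and Y are. *)
  apply: (H Q mQ irrQ _ a (Nf Q * Y + Z * Q ^+ ef Q) Y) => //.
  - by move=> i e; apply: nP; exists i.
  - rewrite dvdp_addl; last by rewrite dvdp_mull // -(prednK eQ) exprS dvdp_mulr.
    by apply: irreducible_not_dvdM; rewrite // -irreducible_poly_coprime // coprimep_sym.
  rewrite eS (perm_big _ (perm_to_rem QS)) big_cons -addrA ZE.
  rewrite addf_div ?expf_neq0 ?phi_neq0 // ?(contraNneq _ QY) // => [|->]; last first.
    by rewrite dvdp0.
  by rewrite rmorphD !rmorphM rmorphXn.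
have as_phi c : phi (asmap p c) = asmap p (phi c) by rewrite /asmap rmorphB rmorphXn.
(* A prime P_i without a pole gets numerator 0 and exponent 0, so its term vanishes and no condition
   applies. *)
exists (a + phi b), (fun i => if P i \in S then Nf (P i) else 0),
  (fun i => if P i \in S then ef (P i) else 0%N), f; split=> //; last first.
  by move=> i; case: ifP => // /SP[].
have -> : phi f = phi f0 + asmap p (phi b) by rewrite -fE -as_phi rmorphD.
rewrite asmapD // addrA eS -addrA; congr (_ + _).
have pS : perm_eq S [seq P i | i <- enum 'I_r & P i \in S].
  apply: uniq_perm => //; first by rewrite map_inj_uniq // filter_uniq // enum_uniq.
  move=> Q; apply/idP/mapP => [QS|[i]]; last by rewrite mem_filter => /andP[h _] ->.
  have [i QE] := SP' Q QS; exists i => //.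
  by rewrite mem_filter -QE QS mem_enum.
rewrite (perm_big _ pS) big_map big_filter big_enum_cond /= big_mkcond /=.
by apply: eq_bigr => i _; case: ifP => // _; rewrite rmorph0 mul0r.
Qed.

End Fractions.
End Reduction.

(** * Artin-Schreier-Witt theory of cyclic extensions *)

Section WittComponents.
Variables (p : nat) (p_pr : prime p) (n : nat) (R : comNzRingType).
Local Notation W := (witt p_pr n R).
Implicit Types x y : W.

Lemma wittD_diff x x' y y' (m : 'I_n) :
  (forall i : 'I_n, (i < m)%N -> x i = x' i) ->
  (forall i : 'I_n, (i < m)%N -> y i = y' i) ->
  (x + y) m - (x' + y') m = (x m - x' m) + (y m - y' m).
Proof. exact: wop_diff. Qed.

Lemma witt0E (i : 'I_n) : (0 : W) i = 0.
Proof. exact: ffunE. Qed.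

Lemma wittD_eq x x' y y' (m : nat) :
  (forall i : 'I_n, (i < m)%N -> x i = x' i) ->
  (forall i : 'I_n, (i < m)%N -> y i = y' i) ->
  forall i : 'I_n, (i < m)%N -> (x + y) i = (x' + y') i.
Proof.
move=> xx' yy' i im; apply/eqP; rewrite -subr_eq0 wittD_diff.
- by rewrite xx' // yy' // !subrr addr0.
- by move=> j ji; apply: xx'; apply: ltn_trans im.
- by move=> j ji; apply: yy'; apply: ltn_trans im.
Qed.

(** The image of the m-fold Verschiebung; on it, entry m is additive. *)
Definition vanishes m x := forall i : 'I_n, (i < m)%N -> x i = 0.

Lemma wittD_vanish x y (m : 'I_n) :
  vanishes m x -> vanishes m y -> (x + y) m = x m + y m.
Proof.
move=> xm ym; have := @wittD_diff x 0 y 0 m.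
rewrite addr0 !witt0E !subr0; apply.
  by move=> i im; rewrite witt0E xm.
by move=> i im; rewrite witt0E ym.
Qed.

Lemma vanishesD m x y : vanishes m x -> vanishes m y -> vanishes m (x + y).
Proof.
move=> xm ym i im; rewrite wittD_vanish; first by rewrite xm // ym // addr0.
  by move=> j ji; apply: xm; apply: ltn_trans im.
by move=> j ji; apply: ym; apply: ltn_trans im.
Qed.

Lemma vanishes0 m : vanishes m 0.
Proof. by move=> i _; exact: witt0E. Qed.

Lemma wittN_vanish x (m : 'I_n) : vanishes m x -> (- x) m = - x m.
Proof.
have [k] := ubnP (val m); elim: k m => // k IH m mk xm.
have Nxm : vanishes m (- x).
  move=> i im; rewrite IH; first by rewrite xm // oppr0.
    exact: leq_trans im _.
  by move=> j ji; apply: xm; apply: ltn_trans im.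
apply/eqP; rewrite -addr_eq0 -wittD_vanish // addNr; apply/eqP; exact: witt0E.
Qed.

Lemma vanishesN m x : vanishes m x -> vanishes m (- x).
Proof.
move=> xm i im; rewrite wittN_vanish; first by rewrite xm // oppr0.
by move=> j ji; apply: xm; apply: ltn_trans im.
Qed.

Lemma witt_sum_vanish N (f : nat -> W) (m : 'I_n) : (forall i, vanishes m (f i)) ->
  vanishes m (\sum_(i < N) f i) /\ (\sum_(i < N) f i) m = \sum_(i < N) f i m.
Proof.
move=> fm; elim: N => [|N [IH1 IH2]].
  by rewrite !big_ord0; split; [exact: vanishes0|exact: witt0E].
by rewrite !big_ord_recr /=; split; [exact: vanishesD|rewrite wittD_vanish // IH2].
Qed.

(** The m-fold Verschiebung of the Teichmüller vector of a. *)
Definition witt_single (m : 'I_n) (a : R) : W := [ffun i => if i == m then a else 0].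

Lemma witt_singleE m a : witt_single m a m = a.
Proof. by rewrite ffunE eqxx. Qed.

Lemma witt_single_vanish (m : 'I_n) a : vanishes m (witt_single m a).
Proof. by move=> i im; rewrite ffunE -val_eqE ltn_eqF. Qed.

End WittComponents.

Lemma witt_single_map (p : nat) (p_pr : prime p) (n : nat) (R S : comNzRingType)
    (phi : {rmorphism R -> S}) (m : 'I_n) (a : R) :
  witt_map phi (witt_single p_pr m a) = witt_single p_pr m (phi a).
Proof.
by apply/ffunP => i; rewrite witt_mapE !ffunE; case: eqP => _; rewrite ?rmorph0.
Qed.

Lemma witt_map_iter (p : nat) (p_pr : prime p) (n : nat) (R : comNzRingType)
    (s : {rmorphism R -> R}) (x : witt p_pr n R) k i :
  iter k (witt_map s) x i = iter k s (x i).
Proof. by elim: k => //= k IH; rewrite witt_mapE IH. Qed.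

Lemma subr_regroup (V : zmodType) (a b c d e : V) :
  a + b - (c + d) - e = (a - c - e) + (b - d).
Proof. by rewrite opprD (addrACA a) (addrAC (a - c)). Qed.

(** * Additive Hilbert 90 for Witt vectors *)

Section Cocycle.
Variables (L : fieldType) (s : {rmorphism L -> L}) (p n : nat) (p_pr : prime p).
Hypothesis pL : p \in [pchar L].
Local Notation N := (p ^ n)%N.
Hypothesis s_order : forall x, iter N s x = x.
Hypothesis s_trace : exists theta, \sum_(i < N) iter i s theta != 0.
Local Notation W := (witt p_pr n L).
Local Notation S := (witt_map s : W -> W).

(* With [t] of trace one and [b_i = c + s c + ... + s^(i-1) c], the element
   [- \sum_i b_i s^i t] does it, since [s b_i = b_(i+1) - c] and [b_N = b_0 = 0]. *)
Lemma additive_hilbert90 c : \sum_(i < N) iter i s c = 0 -> exists z, s z - z = c.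
Proof.
move=> Tc; have [t0 T0] := s_trace; set T := \sum_(i < N) _ in T0.
have sT : s T = T.
  apply: (addrI t0); transitivity (\sum_(i < N.+1) iter i s t0).
    by rewrite big_ord_recl rmorph_sum.
  by rewrite big_ord_recr /= s_order addrC.
pose t := t0 / T.
have it k : iter k s t = iter k s t0 / T.
  by elim: k => //= k ->; rewrite fmorph_div sT.
pose b k := \sum_(j < k) iter j s c.
have sb k : s (b k) = b k.+1 - c.
  by rewrite /b big_ord_recl /= addrC addKr rmorph_sum.
pose g k := b k * iter k s t.
exists (- \sum_(i < N) g i).
have sg k : s (g k) = g k.+1 - c * iter k.+1 s t.
  by rewrite /g rmorphM sb /=; ring.
rewrite rmorphN rmorph_sum (eq_bigr (fun i : 'I_N => g i.+1 - c * iter i.+1 s t)) //.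
rewrite sumrB -mulr_sumr.
have g0 : g 0%N = 0 by rewrite /g /b big_ord0 mul0r.
have gN : g N = 0 by rewrite /g /b Tc mul0r.
have -> : \sum_(i < N) g i.+1 = \sum_(i < N) g i.
  have : \sum_(i < N.+1) g i = \sum_(i < N.+1) g i by [].
  by rewrite {1}big_ord_recl big_ord_recr /= g0 gN add0r addr0.
have -> : \sum_(i < N) iter i.+1 s t = 1.
  rewrite (eq_bigr (fun i : 'I_N => s (iter i s t0 / T))) => [|i _]; last by rewrite /= it.
  by rewrite -rmorph_sum -mulr_suml mulfV // rmorph1.
by ring.
Qed.

Lemma witt_trace_coboundary (y : W) : \sum_(i < N) iter i S (S y - y) = 0.
Proof.
have iN : iter N S y = y by apply/ffunP => i; rewrite witt_map_iter s_order.
have iB k (u v : W) : iter k S (u - v) = iter k S u - iter k S v.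
  by elim: k => //= k ->; rewrite raddfB.
rewrite (eq_bigr (fun i : 'I_N => iter i.+1 S y - iter i S y)); last first.
  by move=> i _; rewrite iB -iterSr.
rewrite -(big_mkord predT (fun i => iter i.+1 S y - iter i S y)) telescope_sumr //.
by rewrite iN subrr.
Qed.

(** The defect d = S y - y - 1 vanishes below m and has trace zero. Its entry m then has trace zero
    in L, so it is s z - z, and adding the vector with -z at m removes it without disturbing the
    lower entries. *)
Lemma witt_cocycle : exists y : W, S y = y + witt1 p_pr n 0 L.
Proof.
have S1 k : iter k S (witt1 p_pr n 0 L) = witt1 p_pr n 0 L.
  by elim: k => //= k ->; rewrite witt1_map.
have T1 : witt1 p_pr n 0 L *+ N = 0.
  rewrite witt1_mulrn //; apply/ffunP => i; rewrite ffunE witt0E.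
  by rewrite (ltn_eqF (ltn_ord i)).
have iB k (u v : W) : iter k S (u - v) = iter k S u - iter k S v.
  by elim: k => //= k ->; rewrite raddfB.
suff [y yP] : exists y : W, vanishes n (S y - y - witt1 p_pr n 0 L).
  exists y; apply/eqP; rewrite -subr_eq0 opprD addrA; apply/eqP/ffunP => i.
  by rewrite yP // witt0E.
suff H m : (m <= n)%N -> exists y : W, vanishes m (S y - y - witt1 p_pr n 0 L).
  exact: H (leqnn n).
elim: m => [_|m IH mn]; first by exists 0.
have [y yP] := IH (ltnW mn); set d := S y - y - _ in yP.
pose m' := Ordinal mn.
have iterV k : vanishes m' (iter k S d).
  by move=> i im; rewrite witt_map_iter yP //; elim: k => //= k ->; rewrite rmorph0.
(* All conjugates of d vanish below m, so entry m of the Witt trace is the ordinary trace of entry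
   m. *)
have [_] := witt_sum_vanish N iterV.
have -> : \sum_(i < N) iter i S d = 0.
  rewrite (eq_bigr (fun i : 'I_N => iter i S (S y - y) - witt1 p_pr n 0 L)).
    rewrite sumrB witt_trace_coboundary sumr_const card_ord.
    by rewrite T1 subr0.
  by move=> i _; rewrite [in LHS]/d [in LHS]iB S1.
rewrite witt0E (eq_bigr (fun i : 'I_N => iter i s (d m'))) => [/esym Td|i _]; last first.
  by rewrite witt_map_iter.
have [z zE] := additive_hilbert90 Td.
pose v := witt_single p_pr m' (- z).
exists (y + v).
have -> : S (y + v) - (y + v) - witt1 p_pr n 0 L = d + (S v - v).
  rewrite raddfD /d; exact: subr_regroup.
have Sv : S v = witt_single p_pr m' (- s z) by rewrite witt_single_map rmorphN.
have vv a : vanishes m' (witt_single p_pr m' a : W) := @witt_single_vanish _ _ _ _ m' a.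
have vSv : vanishes m' (S v - v).
  by rewrite Sv; apply: vanishesD; [exact: vv|apply: vanishesN; exact: vv].
move=> i; rewrite ltnS leq_eqVlt => /orP[/eqP im|im]; last first.
  exact: (vanishesD yP vSv).
have -> : i = m' by apply: val_inj.
rewrite wittD_vanish // Sv wittD_vanish ?wittN_vanish //; try exact: vv.
  by rewrite !witt_singleE -zE; ring.
by apply: vanishesN; exact: vv.
Qed.

Lemma witt_cocycle_iter (y : W) k :
  S y = y + witt1 p_pr n 0 L -> iter k S y = y + witt1 p_pr n 0 L *+ k.
Proof.
move=> Sy; elim: k => [|k IH]; first by rewrite mulr0n addr0.
by rewrite iterS IH raddfD raddfMn /= Sy witt1_map mulrS addrA.
Qed.

(** The gcd of p^n and k is some p^j and also kills the unit vector; but p^j times it has entry 1 at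
    position j unless j = n. *)
Lemma witt1_order k : witt1 p_pr n 0 L *+ k = 0 -> (N %| k)%N.
Proof.
move=> k0; have N0 : witt1 p_pr n 0 L *+ N = 0.
  rewrite witt1_mulrn //; apply/ffunP => i; rewrite ffunE witt0E.
  by rewrite (ltn_eqF (ltn_ord i)).
have g0 : witt1 p_pr n 0 L *+ gcdn N k = 0.
  have N_gt0 : (0 < N)%N by rewrite expn_gt0 prime_gt0.
  case: (egcdnP k N_gt0) => a b e _; rewrite gcdnC in e.
  have := mulrnA (witt1 p_pr n 0 L) N a; rewrite N0 mul0rn mulnC e mulrnDr.
  by rewrite [(b * k)%N]mulnC mulrnA k0 mul0rn add0r gcdnC.
have /(dvdn_pfactor _ _ p_pr)[j jn gE] := dvdn_gcdl N k.
move: g0; rewrite gE witt1_mulrn // => j0.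
suff <- : gcdn N k = N by apply: dvdn_gcdr.
rewrite gE; congr expn; apply/eqP; rewrite eqn_leq jn leqNgt; apply/negP => lt_jn.
have := congr1 (fun f : {ffun 'I_n -> L} => f (Ordinal lt_jn)) j0.
by rewrite ffunE witt0E /= eqxx => /eqP; rewrite oner_eq0.
Qed.

End Cocycle.

(** [X^p - X] has degree p and the p distinct roots 0, ..., p - 1. *)
Lemma pchar_fixed_frobenius (L : fieldType) (p : nat) (u : L) : p \in [pchar L] ->
  u ^+ p = u -> exists i : nat, u = i%:R.
Proof.
move=> pL up; have p_pr := pcharf_prime pL.
pose f : {poly L} := 'X^p - 'X.
have szf : size f = p.+1.
  by rewrite size_polyDl ?size_polyXn // size_polyN size_polyX ltnS prime_gt1.
have rootf x : x ^+ p = x -> root f x by move=> e; rewrite rootE !hornerE e subrr.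
have [//|h] := boolp.EM (exists i : nat, u = i%:R).
have : (size (u :: [seq i%:R | i <- iota 0 p]) < size f)%N.
  apply: max_poly_roots; first by rewrite -size_poly_gt0 szf.
    rewrite /= rootf //=; apply/allP => _ /mapP[i _ ->]; apply: rootf.
    by rewrite -(pFrobenius_autE pL) pFrobenius_aut_nat.
  rewrite /=; apply/andP; split; first by apply/negP => /mapP[i _ e]; apply: h; exists i.
  rewrite map_inj_in_uniq ?iota_uniq // => i j; rewrite !mem_iota !add0n /= => ip jp.
  wlog ij : i j ip jp / (i <= j)%N.
    by move=> H e; case: (leqP i j) => [|/ltnW] ij; [exact: H|apply/esym/H].
  move=> /eqP; rewrite eq_sym -subr_eq0 -natrB // -(dvdn_pcharf pL).
  have lt_p : (j - i < p)%N by rewrite (leq_ltn_trans (leq_subr _ _)).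
  case: (posnP (j - i)) => [/eqP|jgt /(dvdn_leq jgt)]; last by rewrite leqNgt lt_p.
  by rewrite subn_eq0 => ji _; apply/eqP; rewrite eqn_leq ij.
by rewrite /= size_map size_iota szf ltnn.
Qed.

(** * Galois theory of the cyclic extension *)

Section CyclicGalois.
Variables (K : fieldType) (L : splittingFieldType K) (N : nat).
Hypotheses (galL : galois 1%VS {:L}) (cycL : cyclic 'Gal({:L} / 1%VS)%g).
Hypothesis cardL : #|'Gal({:L} / 1%VS)%g| = N.

(** The Galois data are restated for one ring endomorphism, which acts on Witt vectors through
    [witt_map]. An element of nonzero trace exists by independence of automorphisms. In the last
    clause only the identity fixes [ys], and the Galois correspondence applies. *)
Lemma cyclic_galois_generator : exists s : {rmorphism L -> L},
  [/\ (forall x, iter N s x = x),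
      (exists theta, \sum_(i < N) iter i s theta != 0),
      (forall a : K, s a%:A = a%:A),
      (forall x, s x = x -> exists a : K, x = a%:A)
    & forall ys : seq L, (forall i, (forall x, x \in ys -> iter i s x = x) -> (N %| i)%N) ->
        <<1%VS & ys>>%VS = fullv].
Proof.
have /cyclicP[g gE] := cycL.
have gN : #[g]%g = N by rewrite orderE -gE.
have gG : g \in 'Gal({:L} / 1%VS)%g by rewrite gE cycle_id.
have gX k x : (g ^+ k)%g x = iter k g x.
  elim: k => [|k IH]; first by rewrite expg0 gal_id.
  by rewrite expgSr galM ?memvf // IH.
exists g; split.
- by move=> x; rewrite -gX -gN expg_order gal_id.
- have [th _ thP] := @gal_independent_contra _ L {:L}%AS (fun h => h \in 'Gal({:L} / 1%VS)%g)
    (fun=> 1) 1%g (group1 _) (oner_neq0 _).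
  exists th; apply: contra_neq thP => T0.
  rewrite -[RHS]T0 gE.
  have cycE : <[g]>%g = [set (g ^+ val i)%g | i : 'I_N].
    apply/setP => h; apply/idP/imsetP => [/cyclePmin[i]|[i _ ->]]; last exact: mem_cycle.
    by rewrite gN => iN ->; exists (Ordinal iN).
  rewrite cycE big_imset /=; last first.
    move=> i j _ _ /= /eqP; rewrite eq_expg_mod_order gN !modn_small // => /eqP e.
    exact: val_inj.
  by apply: eq_bigr => i _; rewrite mul1r gX.
- by move=> a; apply: (fixed_gal (sub1v _) gG); apply: rpredZ; exact: mem1v.
- move=> x gx; apply/vlineP.
  suff : x \in fixedField 'Gal({:L} / 1%AS)%g by rewrite (galois_fixedField galL).
  apply/fixedFieldP; first exact: memvf.
  move=> h; rewrite gE => /cycleP[i ->]; rewrite gX.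
  by elim: i => //= i ->.
move=> ys H; apply/eqP; rewrite eqEsubv subvf /=.
pose E := <<1%AS & ys>>%AS.
have EE : (E : {vspace L}) = <<1%VS & ys>>%VS by [].
have galE : galois E fullv by apply: galoisS galL; rewrite sub1v subvf.
rewrite -EE -(galois_fixedField galE); apply/subvP => x _.
apply/fixedFieldP; first exact: memvf.
move=> h hE; have : h \in 'Gal({:L} / 1%VS)%g by apply: subsetP hE; apply: galS; exact: sub1v.
rewrite gE => /cycleP[i hi].
have /dvdnP[j ij] : (N %| i)%N.
  apply: H => y yys; rewrite -gX -hi; apply: (fixed_gal (subvf E) hE).
  by apply: seqv_sub_adjoin.
by rewrite hi ij mulnC expgM -gN expg_order expg1n gal_id.
Qed.

End CyclicGalois.

(** * Componentwise reduction and unramified primes *)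

Section DiscreteValuationTheory.
Variables (L : fieldType) (w : L -> int).
Hypothesis wd : dval w.

(** Zero is listed apart because [dval] says nothing about [w 0]. *)
Definition integral_at (u : L) : Prop := u = 0 \/ 0 <= w u.

Lemma dvalM x y : x != 0 -> y != 0 -> w (x * y) = w x + w y.
Proof. by case: wd => h _ _; apply: h. Qed.

Lemma dvalD x y : x != 0 -> y != 0 -> x + y != 0 -> Num.min (w x) (w y) <= w (x + y).
Proof. by case: wd => _ h _; apply: h. Qed.

Lemma dval1 : w 1 = 0.
Proof.
by have := @dvalM 1 1 (oner_neq0 _) (oner_neq0 _); rewrite mulr1 => /eqP;
  rewrite -subr_eq0 opprD addrA subrr add0r oppr_eq0 => /eqP.
Qed.

Lemma dvalN x : w (- x) = w x.
Proof.
have [->|x0] := eqVneq x 0; first by rewrite oppr0.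
have N1 : - 1 != 0 :> L by rewrite oppr_eq0 oner_eq0.
have : w (- 1) + w (- 1) = 0 by rewrite -dvalM // mulrNN mulr1 dval1.
have -> : - x = (-1) * x by rewrite mulN1r.
by rewrite dvalM //; move=> h; lia.
Qed.

Lemma dvalX x k : x != 0 -> w (x ^+ k) = w x *+ k.
Proof.
move=> x0; elim: k => [|k IH]; first by rewrite dval1.
by rewrite exprS dvalM ?expf_neq0 // IH mulrS.
Qed.

Lemma dvalV x : x != 0 -> w x^-1 = - w x.
Proof.
by move=> x0; apply/eqP; rewrite -addr_eq0 -dvalM ?invr_eq0 // mulVf // dval1.
Qed.

Lemma integral_at_subring : is_subring integral_at.
Proof.
split; first by right; rewrite dval1.
- have wl u v : integral_at u -> integral_at v -> integral_at (u + v).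
    have [->|u0] := eqVneq u 0; first by rewrite add0r.
    have [->|v0] := eqVneq v 0; first by rewrite addr0.
    have [uv|uv] := eqVneq (u + v) 0; first by left.
    move=> [/eqP|wu]; first by rewrite (negPf u0).
    move=> [/eqP|wv]; first by rewrite (negPf v0).
    by right; apply: le_trans (dvalD u0 v0 uv); rewrite le_min wu wv.
  move=> x y Ix Iy; apply: wl => //.
  by case: Iy => [->|wy]; [left; rewrite oppr0|right; rewrite dvalN].
move=> x y; have [->|x0] := eqVneq x 0; first by left; rewrite mul0r.
have [->|y0] := eqVneq y 0; first by left; rewrite mulr0.
move=> [/eqP|wx]; first by rewrite (negPf x0).
move=> [/eqP|wy]; first by rewrite (negPf y0).
by right; rewrite dvalM // addr_ge0.
Qed.

Lemma dvalD_lt x y : x != 0 -> w x < 0 -> integral_at y -> x + y != 0 /\ w (x + y) = w x.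
Proof.
move=> x0 wx [->|wy]; first by rewrite addr0.
have [->|y0] := eqVneq y 0; first by rewrite addr0.
have xy : x + y != 0.
  apply: contraTneq wx => /eqP; rewrite addr_eq0 => /eqP->.
  by rewrite dvalN -leNgt.
split=> //; have := dvalD x0 y0 xy.
have Ny0 : - y != 0 by rewrite oppr_eq0.
have := @dvalD (x + y) (- y) xy Ny0; rewrite addrK dvalN => /(_ x0).
by rewrite !ge_min => /orP[h1|h1] /orP[h2|h2]; lia.
Qed.

(** From u^p - u = (u^(p-1) - 1) u: when u has a pole, subtracting 1 does not change the value of
    u^(p-1). *)
Lemma asmap_pole p u : (1 < p)%N -> ~ integral_at u ->
  [/\ asmap p u != 0, w (asmap p u) = w u *+ p & w (asmap p u) < 0].
Proof.
move=> p1 nu; have u0 : u != 0 by apply/eqP => u0; apply: nu; left.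
have wu : w u < 0 by rewrite ltNge; apply/negP => h; apply: nu; right.
have up0 : u ^+ p.-1 != 0 by rewrite expf_neq0.
have wup : w (u ^+ p.-1) < 0.
  by rewrite dvalX // -mulr_natr pmulr_llt0 // ltr0n -ltnS prednK // ltnW.
have I1 : integral_at (- 1) by right; rewrite dvalN dval1.
have [nz e] := dvalD_lt up0 wup I1.
have -> : asmap p u = (u ^+ p.-1 - 1) * u.
  by rewrite /asmap mulrBl mul1r -exprSr prednK // ltnW.
rewrite dvalM // e dvalX // -mulrSr prednK ?(ltnW p1) //.
by split; rewrite ?mulf_neq0 // -mulr_natr pmulr_llt0 // ltr0n ltnW.
Qed.

End DiscreteValuationTheory.

(** * Integrality of Witt sums, entry by entry *)

Section WittIntegrality.
Variables (p : nat) (p_pr : prime p) (n : nat) (L : fieldType).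
Local Notation W := (witt p_pr n L).
Variable C : L -> Prop.
Hypothesis Cr : is_subring C.

(** Entries from m on need not lie in C; replacing them by 0 makes [wop_closed] applicable and
    leaves the lower entries of a sum unchanged. *)
Definition witt_trunc (m : nat) (x : W) : W := [ffun j : 'I_n => if (j < m)%N then x j else 0].

Lemma witt_trunc_eq m (x : W) (i : 'I_n) : (i < m)%N -> x i = witt_trunc m x i.
Proof. by move=> im; rewrite ffunE im. Qed.

Lemma witt_truncD_closed m (x y : W) i :
  (forall j : 'I_n, (j < m)%N -> C (x j)) -> (forall j : 'I_n, (j < m)%N -> C (y j)) ->
  C ((witt_trunc m x + witt_trunc m y) i).
Proof.
move=> Cx Cy; have Ct (z : W) : (forall j : 'I_n, (j < m)%N -> C (z j)) ->
    forall j, C (witt_trunc m z j).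
  by move=> Cz j; rewrite ffunE; case: ifP => [/Cz|_] //; exact: subring0.
rewrite wittDE; apply: wop_closed => //; last by apply: Ct.
- exact: subring1.
- exact: subringB.
- exact: subringM.
- exact: Ct.
Qed.

Lemma wittD_closed m (x y : W) :
  (forall j : 'I_n, (j < m)%N -> C (x j)) -> (forall j : 'I_n, (j < m)%N -> C (y j)) ->
  forall j : 'I_n, (j < m)%N -> C ((x + y) j).
Proof.
move=> Cx Cy j jm; rewrite (wittD_eq (witt_trunc_eq (m := m) x) (witt_trunc_eq (m := m) y)) //.
exact: witt_truncD_closed.
Qed.

(** The carry t is entry m of the sum of the truncations, a polynomial in lower entries only. *)
Lemma wittD_top (x y : W) (m : 'I_n) :
  (forall j : 'I_n, (j < m)%N -> C (x j)) -> (forall j : 'I_n, (j < m)%N -> C (y j)) ->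
  exists2 t, C t & (x + y) m = x m + y m + t.
Proof.
move=> Cx Cy; exists ((witt_trunc m x + witt_trunc m y) m); first exact: witt_truncD_closed.
have := wittD_diff (witt_trunc_eq (m := m) x) (witt_trunc_eq (m := m) y).
rewrite !ffunE ltnn !subr0 => <-; ring.
Qed.

End WittIntegrality.

(** * Poles of the Witt equation at a discrete valuation *)

Section UnramifiedWitt.
Variables (p : nat) (p_pr : prime p) (n : nat) (L : fieldType) (w : L -> int).
Local Notation W := (witt p_pr n L).
Hypothesis wd : dval w.
Variables (y b Fy : W).
Hypothesis FyE : forall i, Fy i = y i ^+ p.
Hypothesis Fyb : Fy = b + y.

(** By induction y_j^p - y_j is b_j plus an integral carry, whereas a pole of y_j would give y_j^p -
    y_j a pole. *)
Lemma asw_integral m : (forall j : 'I_n, (j < m)%N -> integral_at w (b j)) ->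
  forall j : 'I_n, (j < m)%N -> integral_at w (y j).
Proof.
move=> Ib j; have [k] := ubnP (val j); elim: k j => // k IH j jk jm.
have Cr := integral_at_subring wd.
have Iy (i : 'I_n) : (i < j)%N -> integral_at w (y i).
  by move=> ij; apply: IH; [exact: leq_trans ij _|exact: ltn_trans jm].
have Ib' (i : 'I_n) : (i < j)%N -> integral_at w (b i).
  by move=> ij; apply: Ib; exact: ltn_trans jm.
have [t It e] := wittD_top Cr Ib' Iy.
have asE : asmap p (y j) = b j + t by rewrite /asmap -FyE Fyb e; ring.
have [//|nI] := boolp.EM (integral_at w (y j)).
have [as0 _ was] := asmap_pole wd (prime_gt1 p_pr) nI.
have [/eqP|] : integral_at w (asmap p (y j)).
- by rewrite asE; apply: subringD => //; exact: Ib.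
- by rewrite (negPf as0).
- by rewrite leNgt was.
Qed.

(** Here c carries the pole and d is integral. Then y_m^p - y_m is c plus an integral element, so it
    has the value of c, and this value is p times that of y_m. *)
Lemma asw_pole (m : 'I_n) c d :
  (forall j : 'I_n, (j < m)%N -> integral_at w (b j)) -> integral_at w d ->
  b m = c + d -> c != 0 -> w c < 0 -> exists z : int, w c = z *+ p.
Proof.
move=> Ib Id bm c0 wc; have Cr := integral_at_subring wd.
have [t It e] := wittD_top Cr Ib (asw_integral Ib).
have asE : asmap p (y m) = c + (d + t) by rewrite /asmap -FyE Fyb e bm; ring.
have [nz wE] := dvalD_lt wd c0 wc (subringD Cr Id It).
exists (w (y m)); rewrite -wE -asE.
have [Iy|nI] := boolp.EM (integral_at w (y m)); last first.
  by case: (asmap_pole wd (prime_gt1 p_pr) nI).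
have Ias : integral_at w (asmap p (y m)).
  by apply: subringB => //; apply: subringX.
case: Ias => [/eqP|]; first by rewrite asE (negPf nz).
by rewrite asE wE leNgt wc.
Qed.

End UnramifiedWitt.

Section WittFold.
Variables (p : nat) (p_pr : prime p) (n r : nat) (K : fieldType).
Local Notation W := (witt p_pr n K).
Implicit Types (d : 'I_r -> W) (u : W).

(** The nesting is that of [beta] in the theorem, so the two agree by conversion. *)
Definition witt_fold d u (l : seq 'I_r) : W := foldr (fun i acc => d i + acc) u l.

Lemma witt_fold_eq m d d' u u' l :
  (forall i (j : 'I_n), (j < m)%N -> d i j = d' i j) ->
  (forall j : 'I_n, (j < m)%N -> u j = u' j) ->
  forall j : 'I_n, (j < m)%N -> witt_fold d u l j = witt_fold d' u' l j.
Proof.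
move=> dd uu; elim: l => [|a l IH] //= j jm.
exact: (wittD_eq (dd a) IH).
Qed.

Lemma witt_fold_diff (m : 'I_n) d d' u u' l :
  (forall i (j : 'I_n), (j < m)%N -> d i j = d' i j) ->
  (forall j : 'I_n, (j < m)%N -> u j = u' j) ->
  witt_fold d u l m - witt_fold d' u' l m =
  \sum_(i <- l) (d i m - d' i m) + (u m - u' m).
Proof.
move=> dd uu; elim: l => [|a l IH] /=; first by rewrite big_nil add0r.
rewrite wittD_diff; [|exact: dd|exact: (witt_fold_eq l dd uu)].
by rewrite big_cons IH addrA.
Qed.

Lemma witt_fold_closed (C : K -> Prop) m d u l : is_subring C ->
  (forall i (j : 'I_n), (j < m)%N -> C (d i j)) ->
  (forall j : 'I_n, (j < m)%N -> C (u j)) ->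
  forall j : 'I_n, (j < m)%N -> C (witt_fold d u l j).
Proof.
move=> Cr Cd Cu; elim: l => [|a l IH] //= j jm.
exact: (wittD_closed Cr (Cd a) IH).
Qed.

End WittFold.

(** * Reduction of the Witt equation one component at a time *)

Section ComponentwiseReduction.
Variables (F : finFieldType) (p : nat) (p_pr : prime p) (n r : nat).
Hypothesis pF : p \in [pchar F].
Variables (K L : fieldType) (phi : {rmorphism {poly F} -> K}) (iota : {rmorphism K -> L}).
Hypothesis phi_neq0 : forall f, f != 0 -> phi f != 0.
Hypothesis phi_frac : forall c : K, exists N D, D != 0 /\ c = phi N / phi D.
Variable s : {rmorphism L -> L}.
Hypothesis s_iota : forall a, s (iota a) = iota a.
Hypothesis s_fix : forall x, s x = x -> exists a, x = iota a.
Variable P : 'I_r -> {poly F}.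
Hypothesis P_inj : injective P.
Hypothesis P_irr : forall i, P i \is monic /\ irreducible_poly (P i).
Hypothesis unramified : forall Q, Q \is monic -> irreducible_poly Q -> (forall i, Q <> P i) ->
  exists2 w : L -> int, dval w & forall f m, f != 0 -> Q ^+ m %| f -> ~~ (Q ^+ m.+1 %| f) ->
    w (iota (phi f)) = m%:Z.

Local Notation WK := (witt p_pr n K).
Local Notation WL := (witt p_pr n L).

Let pK : p \in [pchar K]. Proof. exact: (rmorph_pchar (phi \o polyC)). Qed.
Let pL : p \in [pchar L]. Proof. exact: (rmorph_pchar iota). Qed.

Definition frobK : {rmorphism K -> K} := pFrobenius_aut pK.
Definition frobL : {rmorphism L -> L} := pFrobenius_aut pL.

Let frobKE a : frobK a = a ^+ p. Proof. exact: pFrobenius_autE. Qed.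
Let frobLE a : frobL a = a ^+ p. Proof. exact: pFrobenius_autE. Qed.

Lemma witt_frob_iota (x : WK) : witt_map frobL (witt_map iota x) = witt_map iota (witt_map frobK x).
Proof. by apply/ffunP => i; rewrite !witt_mapE frobLE frobKE rmorphXn. Qed.

Lemma cocycle_base (y : WL) : witt_map s y = y + witt1 p_pr n 0 L ->
  exists b : WK, witt_map frobL y - y = witt_map iota b.
Proof.
move=> Sy.
have fixS : witt_map s (witt_map frobL y - y) = witt_map frobL y - y.
  have comm : witt_map s (witt_map frobL y) = witt_map frobL (witt_map s y).
    by apply/ffunP => i; rewrite !witt_mapE !frobLE rmorphXn.
  rewrite raddfB /= comm Sy raddfD /= witt1_map opprD addrACA subrr addr0 //.
have comp i : exists a : K, (witt_map frobL y - y) i = iota a.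
  by apply: s_fix; rewrite -[in RHS]fixS witt_mapE.
have [b bE] := boolp.choice comp.
by exists (finfun b); apply/ffunP => i; rewrite witt_mapE bE [finfun b i]ffunE.
Qed.

Definition pole_part (q : 'I_r -> 'I_n -> {poly F}) (e : 'I_r -> 'I_n -> nat) (i : 'I_r) : WK :=
  [ffun j => phi (q i j) / phi (P i) ^+ e i j].
Definition poly_part (f : 'I_n -> {poly F}) : WK := [ffun j => phi (f j)].

(** The invariant of the induction: the entries of b below m have their final form, and the data
    from m on are zero, so that entry m of the fold is exactly the carry from the lower entries. *)
Definition reduced_state (m : nat) (y : WL) (b : WK) q e f : Prop :=
  [/\ witt_map s y = y + witt1 p_pr n 0 L,
      witt_map frobL y - y = witt_map iota b,
      (forall j : 'I_n, (j < m)%N -> b j = witt_fold (pole_part q e) (poly_part f) (enum 'I_r) j),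
      (forall i (j : 'I_n), (0 < e i j)%N -> reduced_pole p (P i) (q i j) (e i j))
      /\ (forall j : 'I_n, (1 < size (f j))%N -> ~~ (p %| (size (f j)).-1)%N)
    & forall j : 'I_n, (m <= j)%N -> f j = 0 /\ forall i, q i j = 0 /\ e i j = 0%N].

(** Adding the vector v with a at m keeps the cocycle relation, as s fixes v, and adds F v - v to b;
    this vanishes below m and is a^p - a at m. *)
Lemma reduction_shift (y : WL) (b : WK) (m : 'I_n) (a : K) :
    witt_map s y = y + witt1 p_pr n 0 L -> witt_map frobL y - y = witt_map iota b ->
  exists y' b', [/\ witt_map s y' = y' + witt1 p_pr n 0 L,
    witt_map frobL y' - y' = witt_map iota b',
    (forall j : 'I_n, (j < m)%N -> b' j = b j) & b' m = b m + asmap p a].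
Proof.
move=> Sy Fy; pose v := witt_single p_pr m a.
have Sv : witt_map s (witt_map iota v) = witt_map iota v.
  by apply/ffunP => i; rewrite !witt_mapE s_iota.
have vv c : vanishes m (witt_single p_pr m c : WK) := @witt_single_vanish _ _ _ _ m c.
have Fv : witt_map frobK v = witt_single p_pr m (a ^+ p).
  by rewrite /v witt_single_map frobKE.
have dv : vanishes m (witt_map frobK v - v).
  by rewrite Fv; apply: vanishesD; [|apply: vanishesN]; exact: vv.
exists (y + witt_map iota v), (b + (witt_map frobK v - v)); split.
- by rewrite raddfD /= Sv Sy addrAC.
- rewrite raddfD /= witt_frob_iota opprD addrACA Fy; apply/esym.
  by rewrite raddfD raddfB.
- move=> j jm; have -> : b j = (b + 0) j by rewrite addr0.
  by apply: wittD_eq jm => // i im; rewrite dv // witt0E.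
have := @wittD_diff p p_pr n K b b (witt_map frobK v - v) 0 m.
rewrite addr0 witt0E subr0 subrr add0r => h.
apply: (addIr (- b m)); rewrite h //; last first.
  by move=> i im; rewrite dv // witt0E.
rewrite Fv wittD_vanish; [|exact: vv|by apply: vanishesN; exact: vv].
rewrite wittN_vanish ?witt_singleE; last exact: vv.
by rewrite /asmap; ring.
Qed.

Lemma pullback_subring (C : L -> Prop) : is_subring C -> is_subring (fun x => C (iota x)).
Proof.
move=> Cr; split; first by rewrite rmorph1; apply: subring1.
  by move=> x y Cx Cy; rewrite rmorphB; apply: subringB.
by move=> x y Cx Cy; rewrite rmorphM; apply: subringM.
Qed.

(** [asw_pole] is applied to the solution shifted by a. Entry m of its right-hand side is the given
    fraction, of value -k at Q, plus entry m of the part already built; that part has poles only at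
    the P_i, so it is integral at Q. *)
Lemma no_new_pole m y b q e f (Q : {poly F}) (mn : (m < n)%N) :
  let m' := Ordinal mn in
  reduced_state m y b q e f ->
  Q \is monic -> irreducible_poly Q -> (forall i, Q <> P i) ->
  forall a X Y k, ~~ (Q %| X) -> ~~ (Q %| Y) -> (0 < k)%N ->
    b m' - witt_fold (pole_part q e) (poly_part f) (enum 'I_r) m' + asmap p a =
      phi X / (phi Q ^+ k * phi Y) -> (p %| k)%N.
Proof.
move=> m' [Sy Fy bE _ z] mQ irrQ QP a X Y k QX QY k0 cE.
have [w wd wv] := unramified mQ irrQ QP.
have Cr := integral_at_subring wd.
have Q0 := irredp_neq0 irrQ.
have ndvd_nz g : ~~ (Q %| g) -> g != 0 by apply: contraNneq => ->; rewrite dvdp0.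
have inz g : g != 0 -> iota (phi g) != 0 by move=> g0; rewrite fmorph_eq0 phi_neq0.
have w_unit g : ~~ (Q %| g) -> w (iota (phi g)) = 0.
  move=> Qg; apply: (wv g 0%N (ndvd_nz g Qg)); first by rewrite expr0; exact: dvd1p.
  by rewrite expr1.
have w_Q : w (iota (phi Q)) = 1.
  apply: (wv Q 1%N Q0); first by rewrite expr1; exact: dvdpp.
  apply/negP => /(dvdp_leq Q0).
  apply/negP; rewrite -ltnNge expr2 size_mul //.
  by case: irrQ => h _; case: (size Q) h => [|[|l]] // _;
  rewrite addSn /= -[X in (X < _)%N]add0n ltn_add2r.
have I_poly g : integral_at w (iota (phi g)).
  have [->|g0] := eqVneq g 0; first by left; rewrite !rmorph0.
  have [l [h [gE Qh]]] := irreducible_multiplicity irrQ g0.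
  have hz := inz h (ndvd_nz h Qh); have Qlz := expf_neq0 l (inz Q Q0).
  right; rewrite gE 2!rmorphM 2!rmorphXn (dvalM wd Qlz hz) (w_unit h Qh) addr0.
  by rewrite (dvalX wd l (inz Q Q0)) w_Q; apply: mulrn_wge0.
have nQP i : ~~ (Q %| P i).
  apply/negP => QPi; apply: (QP i); apply/eqP; have [mP [_ irrP]] := P_irr i.
  by rewrite -eqp_monic // irrP //; case: irrQ => h _; rewrite gtn_eqF.
have I_pole g i l : integral_at w (iota (phi g / phi (P i) ^+ l)).
  rewrite fmorph_div rmorphXn; apply: subringM => //.
  have Pz := inz _ (ndvd_nz _ (nQP i)).
  right; rewrite (dvalV wd (expf_neq0 l Pz)) (dvalX wd l Pz).
  by rewrite (w_unit _ (nQP i)) mul0rn oppr0.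
pose g := witt_fold (pole_part q e) (poly_part f) (enum 'I_r).
have I_g (j : 'I_n) : integral_at w (iota (g j)).
  apply: (@witt_fold_closed p p_pr n r K (fun x => integral_at w (iota x)) n
    (pole_part q e) (poly_part f) (enum 'I_r)) (ltn_ord j).
  - exact: pullback_subring.
  - by move=> i l _; rewrite ffunE.
  - by move=> l _; rewrite ffunE.
have [y' [b' [Sy' Fy' b'E b'm]]] := reduction_shift m' a Sy Fy.
have FyE : witt_map frobL y' = witt_map iota b' + y' by rewrite -Fy' subrK.
have FE i : witt_map frobL y' i = y' i ^+ p by rewrite witt_mapE frobLE.
pose c := phi X / (phi Q ^+ k * phi Y).
have bm : witt_map iota b' m' = iota c + iota (g m').
  by rewrite witt_mapE b'm -rmorphD /c -cE; congr (iota _); rewrite /g; ring.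
have Xz := inz X (ndvd_nz X QX); have Yz := inz Y (ndvd_nz Y QY).
have Qkz := expf_neq0 k (inz Q Q0); have QYz := mulf_neq0 Qkz Yz.
have icE : iota c = iota (phi X) / (iota (phi Q) ^+ k * iota (phi Y)).
  by rewrite /c fmorph_div rmorphM rmorphXn.
have c0 : iota c != 0 by rewrite icE; apply: divf_neq0.
have wc : w (iota c) = - k%:Z.
  have QYz' : (iota (phi Q) ^+ k * iota (phi Y))^-1 != 0 by rewrite invr_eq0.
  rewrite icE (dvalM wd Xz QYz') (dvalV wd QYz) (dvalM wd Qkz Yz) (dvalX wd k (inz Q Q0)).
  by rewrite (w_unit X QX) (w_unit Y QY) w_Q addr0 add0r natz.
have [||z' z'E] := @asw_pole p p_pr n L w wd y' _ _ FE FyE m' (iota c)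
  (iota (g m')) _ (I_g m') bm c0.
- by move=> j jm; rewrite witt_mapE b'E // bE //; exact: I_g.
- by rewrite wc oppr_lt0 ltz_nat.
- move: z'E; rewrite wc => /eqP; rewrite eqr_oppLR => /eqP kE.
  have : (p%:Z %| k%:Z)%Z.
    by apply/dvdzP; exists (- z'); rewrite kE mulNr -mulr_natr natz.
  by rewrite dvdzE.
Qed.

(** What gets reduced is b_m minus the carry g_m. Writing the result into the data at m changes
    entry m of the fold by exactly the new terms, by [witt_fold_diff]. *)
Lemma reduction_step m y b q e f : (m < n)%N -> reduced_state m y b q e f ->
  exists y' b' q' e' f', reduced_state m.+1 y' b' q' e' f'.
Proof.
move=> mn st; pose m' := Ordinal mn.
have nnp := @no_new_pole m y b q e f _ mn st.
case: st => Sy Fy bE [eP fP] z.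
pose g := witt_fold (pole_part q e) (poly_part f) (enum 'I_r).
have [N [D [D0 cE]]] := phi_frac (b m' - g m').
have [|a [qm [em [fm [aE emP fmP]]]]] :=
    @artin_schreier_reduction F p pF K phi phi_neq0 r P N D P_inj D0.
  by move=> Q mQ iQ QP a X Y k QX QY k0; rewrite -cE; apply: nnp.
have [y' [b' [Sy' Fy' b'E b'm]]] := reduction_shift m' a Sy Fy.
pose q' i j := if j == m' then qm i else q i j.
pose e' i j := if j == m' then em i else e i j.
pose f' j := if j == m' then fm else f j.
have low (j : 'I_n) : (j < m')%N -> (j == m') = false.
  by move=> jm; rewrite -val_eqE ltn_eqF.
have dd i (j : 'I_n) : (j < m')%N -> pole_part q' e' i j = pole_part q e i j.
  by move=> jm; rewrite !ffunE /q' /e' low.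
have uu (j : 'I_n) : (j < m')%N -> poly_part f' j = poly_part f j.
  by move=> jm; rewrite !ffunE /f' low.
exists y', b', q', e', f'; split=> //.
- move=> j; rewrite ltnS leq_eqVlt => /orP[/eqP jm|jm]; last first.
    by rewrite b'E // bE // (witt_fold_eq _ dd uu).
  have -> : j = m' by apply: val_inj.
  have := witt_fold_diff (enum 'I_r) dd uu; rewrite -/g => /eqP.
  rewrite subr_eq => /eqP ->; rewrite b'm.
  have -> : b m' + asmap p a = (b m' - g m' + asmap p a) + g m' by ring.
  rewrite cE aE; congr (_ + _); have [fz qz] := z m' (leqnn _).
  rewrite big_enum !ffunE /f' eqxx fz rmorph0 subr0; congr (_ + _).
  apply: eq_bigr => i _; rewrite !ffunE /q' /e' eqxx; have [-> _] := qz i.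
  by rewrite rmorph0 mul0r subr0.
- split=> [i j|j]; first by rewrite /e' /q'; case: eqP => _; [exact: emP|exact: eP].
  by rewrite /f'; case: eqP => _; [exact: fmP|exact: fP].
- move=> j mj; have jm : (j == m') = false by rewrite -val_eqE gtn_eqF.
  by rewrite /f' /q' /e' jm; apply: z; apply: ltnW.
Qed.

Lemma witt_reduction (y0 : WL) : witt_map s y0 = y0 + witt1 p_pr n 0 L ->
  exists y b q e f, reduced_state n y b q e f
    /\ b = witt_fold (pole_part q e) (poly_part f) (enum 'I_r).
Proof.
move=> Sy0.
suff H m : (m <= n)%N -> exists y b q e f, reduced_state m y b q e f.
  have [y [b [q [e [f st]]]]] := H n (leqnn n); exists y, b, q, e, f; split=> //.
  by case: st => _ _ bE _ _; apply/ffunP => j; apply: bE.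
elim: m => [_|m IH mn].
  have [b bE] := cocycle_base Sy0.
  exists y0, b, (fun _ _ => 0), (fun _ _ => 0%N), (fun=> 0); split=> //.
  by split=> // j; rewrite size_poly0.
have [y [b [q [e [f st]]]]] := IH (ltnW mn).
exact: reduction_step mn st.
Qed.

End ComponentwiseReduction.

Theorem theorem5p3p1 (F : finFieldType) (p n r : nat)
    (L : splittingFieldType (ratfun F)) (P : 'I_r -> {poly F}) :
  prime p -> p \in [pchar F] -> (0 < n)%N ->
  galois 1%VS {:L} -> cyclic 'Gal({:L} / 1%VS)%g ->
  #|'Gal({:L} / 1%VS)%g| = (p ^ n)%N ->
  injective P ->
  (forall i, P i \is monic /\ irreducible_poly (P i)) ->
  (forall Q : {poly F}, Q \is monic -> irreducible_poly Q ->
     ramified_at L Q <-> exists i, Q = P i) ->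
  exists (y : {ffun 'I_n -> L}) (e : 'I_r -> 'I_n -> nat)
         (Q : 'I_r -> 'I_n -> {poly F}) (f : 'I_n -> {poly F}),
    let delta (i : 'I_r) : {ffun 'I_n -> ratfun F} :=
      [ffun j => tofrac (Q i j) / (tofrac (P i)) ^+ (e i j)] in
    let mu : {ffun 'I_n -> ratfun F} := [ffun j => tofrac (f j)] in
    let beta : {ffun 'I_n -> ratfun F} :=
      foldr (fun i acc => witt_add p (delta i) acc) mu (enum 'I_r) in
    [/\ (<<1%VS & [seq y j | j <- enum 'I_n]>>)%VS = fullv,
        witt_sub p [ffun j => y j ^+ p] y = [ffun j => (beta j)%:A],
        (forall j : 'I_n, val j = 0%N -> forall a : ratfun F, a ^+ p - a != beta j),
        (forall i j, (0 < e i j)%N ->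
           [/\ ~~ (p %| e i j)%N, coprimep (Q i j) (P i)
             & (size (Q i j) < size (P i ^+ e i j))%N])
      & (forall j, (1 < size (f j))%N -> ~~ (p %| (size (f j)).-1)%N)].
Proof.
move=> p_pr pF n_gt0 galL cycL cardL P_inj P_irr ramP.
have [s [s_ord s_tr s_k s_fix s_gen]] := cyclic_galois_generator galL cycL cardL.
pose phi : {rmorphism {poly F} -> ratfun F} := @tofrac {poly F}.
pose iota : {rmorphism ratfun F -> L} := in_alg L.
have pL : p \in [pchar L].
  exact: (rmorph_pchar iota (rmorph_pchar phi (rmorph_pchar (@polyC F) pF))).
have phi_neq0 f : f != 0 -> phi f != 0 by rewrite tofrac_eq0.
have phi_frac (c : ratfun F) : exists N D, D != 0 /\ c = phi N / phi D by exact: fractionP.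
have unram Q : Q \is monic -> irreducible_poly Q -> (forall i, Q <> P i) ->
    exists2 w : L -> int, dval w & forall f m, f != 0 -> Q ^+ m %| f -> ~~ (Q ^+ m.+1 %| f) ->
      w (iota (phi f)) = m%:Z.
  move=> mQ irrQ QP; have [w [e [wd wQ e_gt0]]] := exists_extended_valuation L irrQ.
  (* [ramified_at] asks for some valuation of index above 1, so at a prime outside P every one has
     index at most 1, in particular the one just constructed. *)
  have e1 : e = 1%N.
    apply/eqP; rewrite eqn_leq e_gt0 andbT leqNgt; apply/negP => e_gt1.
    have /(ramP Q mQ irrQ)[i Qi] : ramified_at L Q by exists w, e.
    exact: (QP i Qi).
  by exists w => // f m f0 Qf nQf; rewrite -[m]mul1n -e1; apply: wQ.
have [y0 Sy0] := witt_cocycle p_pr pL s_ord s_tr.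
have [y [b [q [e [f [[Sy Fy _ [eP fP] _] bE]]]]]] :=
  witt_reduction (phi := phi) (iota := iota) (s := s) pF phi_neq0 phi_frac
    s_k s_fix P_inj P_irr unram Sy0.
exists y, e, q, f => delta mu beta.
have betaE : beta = b by rewrite bE.
have FyE : witt_sub p [ffun j => y j ^+ p] y = [ffun j => (beta j)%:A].
  transitivity (witt_map iota b); last by apply/ffunP => j; rewrite witt_mapE !ffunE betaE.
  rewrite -Fy wittBE; apply: (congr1 (fun u => wop p true u y)).
  by apply/ffunP => j; rewrite [LHS]ffunE [RHS]witt_mapE; apply/esym/pFrobenius_autE.
split=> //.
- apply: s_gen => i fix_i; apply: (@witt1_order L p n p_pr pL).
  apply: (addrI (y : witt p_pr n L)); rewrite addr0 -(witt_cocycle_iter i Sy).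
  apply/ffunP => j; rewrite witt_map_iter; apply: fix_i.
  by apply/mapP; exists j => //; rewrite mem_enum.
(* If beta_1 = a^p - a, then y_1 - a is a root of [X^p - X], so it lies in the prime field and is
   fixed by s; but s adds 1 to it. *)
- move=> j j0 a; apply/eqP => aE.
  have van (x : witt p_pr n L) : vanishes j x by move=> i; rewrite j0.
  have y_as : y j ^+ p - y j = iota (beta j).
    rewrite betaE -witt_mapE -Fy wittD_vanish // wittN_vanish // witt_mapE.
    by congr (_ - _); apply/esym/pFrobenius_autE.
  have s_y : s (y j) = y j + 1.
    by rewrite -witt_mapE Sy wittD_vanish // ffunE j0.
  have [|i uE] := @pchar_fixed_frobenius L p (y j - iota a) pL.
    have : y j ^+ p - y j = iota a ^+ p - iota a by rewrite y_as -aE rmorphB rmorphXn.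
    rewrite (exprBp_pchar pL) => /eqP; rewrite subr_eq => /eqP ->.
    by rewrite addrAC [_ - iota a - _]addrAC subrr add0r addrC.
  have := congr1 s uE; rewrite rmorph_nat rmorphB s_y s_k -uE.
  by rewrite addrAC -[RHS]addr0 => /addrI/eqP; rewrite oner_eq0.
- by move=> i j /eP /and3P[].
Qed.
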